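(* Let $q$ be an odd prime power, let $N,Q\in\mathbb{N}$ with $2Q\le N\le 4Q$, and let $a_g\in\mathbb{C}$ for $g\in\mathbb{F}_q[t]$. Then \[ \sum_{\substack{f\in\mathbb{F}_q[t]\setminus\{0\}\\ \deg f\le Q}}\ \sum_{\substack{r\bmod f^2\\ (r,f)=1}}\Bigg|\sum_{\substack{g\in\mathbb{F}_q[t]\\ \deg g\le N}}a_g\,e\Big(g\cdot\frac{r}{f^2}\Big)\Bigg|^2 \ \le\ C_q\, 2^{Q+N}\Big(q^{3Q}+\min\big\{q^{2Q+N/2},\,q^{Q/2+N}\big\}\Big)\sum_{\substack{g\in\mathbb{F}_q[t]\\ \deg g\le N}}|a_g|^2, \] where $C_q$ is a constant depending only on $q$.
   Context: $\mathbb{F}_q$ has characteristic $p$ and $\mathrm{Tr}:\mathbb{F}_q\to\mathbb{F}_p$ is the trace. $\mathbb{F}_q(t)_\infty=\mathbb{F}_q((1/t))$ with $|\sum_{i\le n}a_it^i|_\infty=q^n$ if $a_n\neq0$. The character $e:\mathbb{F}_q(t)_\infty\to\mathbb{C}^\times$ is $e(\sum_{i\le n}a_it^i)=\exp(\tfrac{2\pi i}{p}\mathrm{Tr}(a_{-1}))$; it is trivial on $\mathbb{F}_q[t]$, so the summand depends only on $r\bmod f^2$. The sum over $r$ is over residue classes modulo $f^2$ coprime to $f$. *)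

(* Defs.v *)
From mathcomp Require Import all_boot all_order all_algebra all_fingroup all_field.
From mathcomp Require Import zify.
From mathcomp.real_closed Require Import complex.
From mathcomp Require Import reals exp trigo.

Set Implicit Arguments.
Unset Strict Implicit.
Unset Printing Implicit Defensive.
Import Order.TTheory GRing.Theory Num.Theory.
Local Open Scope ring_scope.
Local Open Scope complex_scope.

Notation "x %:F" := (@FracField.tofrac _ x) : ring_scope.

(* F((1/t)): [lcoef x i] is the coefficient of t^i. *)
Record laurent (F : fieldType) := Laurent {
  lcoef : int -> F;
  lcoef_bounded : exists n : int, forall i : int, n < i -> lcoef i = 0 }.

Section Expansion.
Variable F : fieldType.
Implicit Types (f g h : {poly F}) (x : {fraction {poly F}}).

(* The coefficient of t^i in g/h. Multiplying g by t^|i| moves this coefficient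
   to a nonnegative degree, i.e. into the polynomial part of t^|i| g/h. *)
Definition ratio_coef g h (i : int) : F :=
  ((g * 'X^(absz i)) %/ h)`_(absz (i + absz i)).

Fact ratio_coef_bounded g h :
  exists n : int, forall i : int, n < i -> ratio_coef g h i = 0.
Proof.
exists (size g)%:Z => i lt_gi; rewrite /ratio_coef nth_default //.
apply: leq_trans (leq_divp _ _) _; apply: leq_trans (size_polyMleq _ _) _.
rewrite size_polyXn.
by case: i lt_gi => // i; rewrite ltz_nat -PoszD addnS leq_add2r => /ltnW.
Qed.

(* The embedding of F(t) in its completion F((1/t)). *)
Definition laurent_expand x : laurent F :=
  Laurent (ratio_coef_bounded \n_(generic_quotient.repr x) \d_(generic_quotient.repr x)).

Let divp_shift g h (k m : nat) : h != 0 ->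
  ((g * 'X^(k.+1)) %/ h)`_(m.+1) = ((g * 'X^k) %/ h)`_m.
Proof.
move=> h0; rewrite exprSr mulrA {1}(divp_eq (g * 'X^k) h) mulrDl divpD coefD.
rewrite mulrAC mulpK // coefMX /= [X in _ + X]nth_default ?addr0 //.
have [r0|r0] := eqVneq ((g * 'X^k) %% h) 0.
  by rewrite r0 mul0r div0p size_poly0.
have := ltn_modpN0 (g * 'X^k) h0.
rewrite size_divp // size_mulX // => lt_rh.
by move: lt_rh; case: (size h) => [|n] //=; rewrite ltnS leq_subLR addnC => le; apply: leq_trans le _; rewrite leq_addl.
Qed.

Lemma ratio_coefE g h (k m : nat) : h != 0 ->
  ratio_coef g h (m%:Z - k%:Z) = ((g * 'X^k) %/ h)`_m.
Proof.
move=> h0.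
have H n k' m' : ((g * 'X^(k' + n)) %/ h)`_(m' + n) = ((g * 'X^k') %/ h)`_m'.
  by elim: n => [|n IHn]; rewrite ?addn0 // !addnS divp_shift.
rewrite /ratio_coef; set a := absz _; set b := absz (_ + _).
have [le_ak|/ltnW le_ka] := leqP a k.
  have -> : k = (a + (k - a))%N by lia.
  have -> : m = (b + (k - a))%N by lia.
  by rewrite H.
have -> : a = (k + (a - k))%N by lia.
have -> : b = (m + (a - k))%N by lia.
by rewrite H.
Qed.

Lemma laurent_expandE g h (k m : nat) : h != 0 ->
  lcoef (laurent_expand (g%:F / h%:F)) (m%:Z - k%:Z) = ((g * 'X^k) %/ h)`_m.
Proof.
move=> h0; rewrite /laurent_expand /=; set u := generic_quotient.repr _.
have d0 : \d_u != 0 by apply: denom_ratioP.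
rewrite ratio_coefE //.
have E : \n_u * h = \d_u * g.
  apply/eqP; rewrite -(tofrac_eq (\n_u * h)) !tofracM.
  have hF0 : h%:F != 0 by rewrite tofrac_eq0.
  have dF0 : (\d_u)%:F != 0 by rewrite tofrac_eq0.
  suff Ex : g%:F / h%:F = (\n_u)%:F / (\d_u)%:F.
    by rewrite -[g%:F](divfK hF0) Ex mulrA [_%:F * (_ / _)]mulrC divfK.
  rewrite -[LHS]reprK -/u; unlock FracField.tofrac.
  rewrite -[X in _ = _ * X]FracField.pi_inv -[RHS]FracField.pi_mul.
  rewrite /FracField.mulf /FracField.invf !numden_Ratio ?oner_neq0 //.
  by rewrite mulr1 mul1r Ratio_numden.
by rewrite -(divp_pmul2r _ h0 d0) mulrAC E -mulrA divp_pmul2l //.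
Qed.

(* The expansion x of g/h is the element of F((1/t)) with h * x = g. *)
Lemma laurent_expandP g h (i : int) : h != 0 ->
  \sum_(j < size h) h`_j * lcoef (laurent_expand (g%:F / h%:F)) (i - j%:Z) =
  if 0 <= i then g`_(absz i) else 0.
Proof.
move=> h0; pose k := (absz i + size h)%N; pose m := absz (i + k%:Z).
have Em : m%:Z = i + k%:Z by lia.
have le_hm : (size h <= m)%N by lia.
transitivity ((h * ((g * 'X^k) %/ h))`_m).
  rewrite coefM (big_ord_widen m.+1 (fun j => h`_j *
    lcoef (laurent_expand (g%:F / h%:F)) (i - j%:Z))); last by lia.
  rewrite big_mkcond; apply: eq_bigr => j _.
  case: ltnP => [lt_jh|le_hj]; last by rewrite nth_default ?mul0r.
  have le_jm : (j <= m)%N by rewrite -ltnS.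
  have -> : i - j%:Z = (m - j)%N%:Z - k%:Z by rewrite -subzn // Em; lia.
  by rewrite laurent_expandE.
have -> : h * ((g * 'X^k) %/ h) = g * 'X^k - (g * 'X^k) %% h.
  by rewrite {2}(divp_eq (g * 'X^k) h) addrK mulrC.
rewrite coefB [X in _ - X]nth_default ?subr0; last first.
  by apply: leq_trans le_hm; apply: ltnW; rewrite ltn_modp.
rewrite coefMXn; case: (lerP 0 i) => i0; case: ltnP => mk //; try lia.
congr (g`_ _); lia.
Qed.

End Expansion.

(* The residue classes modulo m != 0 are represented by the polynomials of
   degree < deg m (only 0 if m is a nonzero constant). *)
Notation residue m := {poly_(size m).-1 _}.

Section Character.
Variable F : finFieldType.

Definition pcharF : nat := s2val (finPcharP F).

Lemma pcharF_prime : prime pcharF.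
Proof. exact: (s2valP (finPcharP F)). Qed.

Lemma pcharF_pchar : pcharF \in [pchar F].
Proof. exact: (s2valP' (finPcharP F)). Qed.

(* F as a field extension of its prime field *)
Local Notation L := (pPrimeCharType pcharF_pchar).

Definition Tr (x : F) : 'F_pcharF :=
  odflt 0 [pick k : 'F_pcharF | k%:A == galTrace 1 {:L} x].

Lemma TrE (x : F) : (Tr x)%:A = galTrace 1 {:L} x.
Proof.
rewrite /Tr; case: pickP => [k /eqP //|noTr].
have: galTrace 1 {:L} x \in 1%VS.
  by rewrite mem_galTrace ?memvf //; apply: finField_galois; apply: sub1v.
by case/vlineP=> k Ek; have := noTr k; rewrite Ek eqxx.
Qed.

Variable R : realType.

(* exp (2 pi i Tr(x_{-1}) / p), written as cos + i sin *)
Definition echar (x : laurent F) : R[i] :=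
  let theta : R := 2 * pi * (Tr (lcoef x (-1)))%:R / pcharF%:R in
  cos theta +i* sin theta.

(* The summand depends only on r mod f^2. *)
Lemma echar_modE (f g r s : {poly F}) : f != 0 ->
  echar (laurent_expand (g%:F * ((r + s * f ^+ 2)%:F / f%:F ^+ 2))) =
  echar (laurent_expand (g%:F * (r%:F / f%:F ^+ 2))).
Proof.
move=> f0; have f20 : f ^+ 2 != 0 by rewrite expf_neq0.
have E u : g%:F * (u%:F / f%:F ^+ 2) = (g * u)%:F / (f ^+ 2)%:F.
  by rewrite tofracM tofracXn mulrA.
rewrite !E /echar; move: (f ^+ 2) f20 => d d0.
suff -> : lcoef (laurent_expand ((g * (r + s * d))%:F / d%:F)) (-1) =
          lcoef (laurent_expand ((g * r)%:F / d%:F)) (-1) by [].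
have -> : (-1 : int) = 0%N%:Z - 1%N%:Z by [].
rewrite !laurent_expandE // mulrDr mulrDl divpD coefD.
have -> : g * (s * d) * 'X^1 = g * s * 'X * d by rewrite expr1 !mulrA mulrAC.
by rewrite mulpK // coefMX addr0.
Qed.

End Character.
Arguments echar {F} R x.

(* Main.v *)
Require Import Defs.
From mathcomp Require Import all_boot all_order all_algebra all_fingroup all_field.
From mathcomp.real_closed Require Import complex.
From mathcomp Require Import reals exp trigo.
From mathcomp Require Import boolp mxabelem.
From mathcomp Require Import zify ring lra.

(* Expanding r/f^2 to precision t^(-N-1) gives a polynomial Y of degree at most N,
   and e(g r/f^2) depends only on Y. Parseval over all Y bounds the left-hand side
   by q^(N+1) K sum |a_g|^2, where K is the largest number of fractions r/f^2 with
   the same Y. Such f of degree n satisfy: f^2 Y = r T + O(t^(2n-1)) with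
   T = t^(N+1) and r prime to f, so (f^2, f^2 Y mod T) is a short vector of the
   lattice of pairs (h, k) with h Y = k mod T, which has determinant T.

   Let (m, s) be a shortest nonzero vector of this lattice, of norm j. If f^2 is
   parallel to it then f^2 = c m with c constant because r is prime to f, so
   there are at most 2q such f.
   - Bound with q^(2Q+N/2): differences of two squares f1^2 - f2^2 are again short,
     there are few short vectors unless all are parallel to (m, s), and
     each nonzero h is a difference of two squares in at most q 2^(deg h) ways.
   - Bound with q^(Q/2+N), j <= n: the determinant w of (f^2, f^2 Y mod T) and
     (m, s), divided by T, takes few values, and for a given w all the f are
     square roots modulo m of one residue class.
   - Bound with q^(Q/2+N), j > n: the number of f with prescribed leading
     coefficients of f^2 Y mod T has a small variance, since by duality of a
     Hankel matrix the number of pairs with equal coefficients is governed by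
     products u l lying in the lattice.
   The divisor bound 2^deg is responsible for the factor 2^(Q+N). *)

Set Implicit Arguments.
Unset Strict Implicit.
Unset Printing Implicit Defensive.
Import Order.TTheory GRing.Theory Num.Theory Normc.
Local Open Scope ring_scope.

(** * Counting polynomials *)

Definition psize (F : finFieldType) (p : {poly F}) : nat := size p.

(* Terms [size p] elaborated through different structures of [F] are convertible
   but not syntactically equal, so they are distinct atoms for [lia]. *)
Ltac size_lia :=
  repeat match goal with
  | |- context [@size ?A (@polyseq ?S ?p)] =>
      change (@size A (@polyseq S p)) with (psize p)
  | H : context [@size ?A (@polyseq ?S ?p)] |- _ =>
      change (@size A (@polyseq S p)) with (psize p) in H
  end; lia.

Section Counting.

Lemma leq_card_fibers (I : finType) (T : eqType) (A : {set I}) (phi : I -> T)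
    (s : seq T) (k : nat) :
  {in A, forall x, phi x \in s} ->
  {in A, forall x, #|[set y in A | phi y == phi x]| <= k}%N ->
  (#|A| <= size s * k)%N.
Proof.
elim: s A => [|t s IHs] A sA fibA.
  by rewrite leqn0 cards_eq0; apply/eqP/setP=> x; rewrite inE; apply/negP=> /sA.
have -> : A = [set y in A | phi y == t] :|: [set y in A | phi y != t].
  by apply/setP=> x; rewrite !inE -andb_orr orbN andbT.
rewrite (leq_trans (leq_card_setU _ _)) //= mulSn leq_add //.
  have [->|[x]] := set_0Vmem [set y in A | phi y == t]; first by rewrite cards0.
  by rewrite inE => /andP[Ax /eqP <-]; apply: fibA.
apply: IHs => x; rewrite inE => /andP[Ax xt].
  by have := sA x Ax; rewrite inE (negPf xt).
apply: leq_trans (fibA x Ax); apply: subset_leq_card.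
by apply/subsetP=> y; rewrite !inE => /andP[/andP[-> _] ->].
Qed.

Variable F : finFieldType.
Implicit Types f g h m : {poly F}.

Lemma leq_size_sub g h : (size (g - h)%R <= maxn (size g) (size h))%N.
Proof. by rewrite (leq_trans (size_polyD _ _)) ?size_polyN. Qed.

Lemma leq_size_mul g h : (size (g * h)%R <= (size g + size h).-1)%N.
Proof. exact: size_polyMleq. Qed.

Lemma leq_card_poly_fibers (I : finType) (A : {set I}) (phi : I -> {poly F})
    (l k : nat) :
  {in A, forall x, size (phi x) <= l}%N ->
  {in A, forall x, #|[set y in A | phi y == phi x]| <= k}%N ->
  (#|A| <= #|F| ^ l * k)%N.
Proof.
move=> sA fibA.
have := @leq_card_fibers _ _ A phi [seq (p : {poly F}) | p : {poly_l F}] k.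
rewrite size_image card_npoly; apply=> // x Ax.
by apply/imageP; exists (npolyp l (phi x)); rewrite ?npolypK ?sA.
Qed.

Lemma leq_card_poly (I : finType) (A : {set I}) (phi : I -> {poly F}) (l : nat) :
  {in A, forall x, size (phi x) <= l}%N -> {in A &, injective phi} ->
  (#|A| <= #|F| ^ l)%N.
Proof.
move=> sA injA; rewrite -[leqRHS]muln1; apply: leq_card_poly_fibers sA _ => x Ax.
apply: leq_trans (subset_leq_card (B := [set x]) _) _; last by rewrite cards1.
by apply/subsetP=> y; rewrite !inE => /andP[Ay /eqP /injA->].
Qed.

(** With one element [y] fixed, [x] is recovered from the quotient of [g * (psi x - psi y)] by [m].
    The factor [g] serves for congruences known only modulo [m / g]. *)
Lemma leq_card_multiples (I : finType) (A : {set I}) (psi : I -> {poly F})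
    (m g : {poly F}) (l : nat) :
  m != 0 -> g != 0 -> {in A &, injective psi} ->
  {in A &, forall x y, exists2 c : {poly F}, (size c <= l)%N & g * (psi x - psi y) = c * m} ->
  (#|A| <= #|F| ^ l)%N.
Proof.
move=> m0 g0 injA mA; have [->|[y Ay]] := set_0Vmem A.
  by rewrite cards0.
apply: (leq_card_poly (phi := fun x => (g * (psi x - psi y)) %/ m)).
  by move=> x Ax; have [c sc ->] := mA x y Ax Ay; rewrite mulpK.
move=> x x' Ax Ax'; have [c _ Ec] := mA x y Ax Ay; have [d _ Ed] := mA x' y Ax' Ay.
rewrite Ec Ed !mulpK // => cd; apply: injA => //.
by move: Ec; rewrite cd -Ed => /(mulfI g0)/addIr.
Qed.

(** If [h = h' * P] with [P] irreducible, a divisor of [h] divides [h'] or is [P] times a divisor of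
    [h'], so the list at most doubles at each step. The factor [#|F|] counts the constants. *)
Lemma poly_divisors h : h != 0 ->
  exists2 s : seq {poly F}, (size s <= #|F| * 2 ^ (size h).-1)%N &
    forall u, u %| h -> u \in s.
Proof.
have [n] := ubnP (size h); elim: n h => // n IHn h; rewrite ltnS => hn h0.
have [h1|h1] := leqP (size h) 1.
  exists [seq c%:P | c : F] => [|u uh].
    by rewrite size_image leq_pmulr // expn_gt0.
  have /size1_polyC -> : (size u <= 1)%N.
    by apply: leq_trans (dvdp_leq h0 uh) h1.
  by apply/imageP; exists u`_0.
have [P [irrP PdvdH]] : exists P, irreducible_poly P /\ P %| h.
  have [m] := ubnP (size h); elim: m h {n IHn hn} h0 h1 => // m IHm h h0 h1.
  rewrite ltnS => hm.
  have [/irreducibleP irrh|redh] := boolP (irreducibleb h).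
    by exists h; rewrite dvdpp.
  move: redh; rewrite /irreducibleb h1 /= => /forallPn[u].
  rewrite negb_imply -ltnNge => /andP[/= uh u1].
  rewrite -Pdiv.Idomain.dvdpE in uh.
  have [] := IHm u _ u1 _.
  - by rewrite -size_poly_gt0 ltnW.
  - by have := size_npoly u; size_lia.
  by move=> P [irrP Pu]; exists P; split=> //; apply: dvdp_trans Pu uh.
have P0 := irredp_neq0 irrP; have [P1 _] := irrP.
move: (PdvdH); rewrite dvdp_eq => /eqP; set h' := h %/ P => Eh.
have h'0 : h' != 0 by apply: contraNneq h0 => h'0; rewrite Eh h'0 mul0r.
have Esz : size h = (size h' + (size P).-1)%N.
  by rewrite [in LHS]Eh size_mul //; size_lia.
have [|s szs ins] := IHn h' _ h'0; first by size_lia.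
exists (s ++ [seq P * u | u <- s]) => [|u uh].
  rewrite size_cat size_map addnn -mul2n; apply: (leq_trans (leq_mul (leqnn 2) szs)).
  rewrite mulnCA leq_mul // -expnS leq_exp2l //.
  have: (0 < size h')%N by rewrite size_poly_gt0.
  by size_lia.
rewrite mem_cat; have [Pu|nPu] := boolP (P %| u).
  apply/orP; right; move: Pu; rewrite dvdp_eq => /eqP Eu.
  rewrite Eu mulrC; apply/mapP; exists (u %/ P) => //; apply: ins.
  by move: uh; rewrite {1}Eu Eh dvdp_mul2r.
rewrite ins //; move: uh; rewrite {1}Eh Gauss_dvdpl // coprimep_sym.
by rewrite irreducible_poly_coprime.
Qed.

End Counting.

(** * Short vectors of a lattice *)

Section Lattice.

Variables (F : finFieldType) (N : nat) (Y : {poly F}).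
Implicit Types f g h m c : {poly F}.

(* [(h, lrem h)] is the lattice vector with first coordinate [h], [lnorm h] its norm,
   and ['X^(N.+1) * ldet m h] its determinant with [(m, lrem m)]. *)
Definition lquo h : {poly F} := (h * Y) %/ 'X^(N.+1).
Definition lrem h : {poly F} := (h * Y) %% 'X^(N.+1).
Definition lnorm h : nat := maxn (size h).-1 (size (lrem h)).
Definition ldet m h : {poly F} := lquo h * m - h * lquo m.

Lemma lquo_rem h : h * Y = lquo h * 'X^(N.+1) + lrem h.
Proof. exact: divp_eq. Qed.

Lemma size_lrem h : (size (lrem h) <= N.+1)%N.
Proof. by rewrite -ltnS -(size_polyXn F N.+1) ltn_modp -size_poly_gt0 size_polyXn. Qed.

Lemma lquo_remE h u v : h * Y = u * 'X^(N.+1) + v -> (size v <= N.+1)%N ->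
  lquo h = u /\ lrem h = v.
Proof.
move=> E sv; have s : (size v < size ('X^(N.+1) : {poly F}))%N.
  by rewrite size_polyXn ltnS.
rewrite /lquo /lrem E divp_addl_mul_small // modp_addl_mul_small //.
Qed.

Lemma lquoB g h : lquo (g - h) = lquo g - lquo h.
Proof. by rewrite /lquo mulrBl divpD divpN. Qed.

Lemma lremB g h : lrem (g - h) = lrem g - lrem h.
Proof. by rewrite /lrem mulrBl modpD modpN. Qed.

Lemma ldetB m g h : ldet m (g - h) = ldet m g - ldet m h.
Proof. rewrite /ldet lquoB; ring. Qed.

Lemma lnormB R g h : (lnorm g <= R)%N -> (lnorm h <= R)%N -> (lnorm (g - h) <= R)%N.
Proof.
rewrite /lnorm !geq_max lremB => /andP[g1 g2] /andP[h1 h2]; apply/andP; split.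
  have := leq_size_sub g h; size_lia.
have := leq_size_sub (lrem g) (lrem h); size_lia.
Qed.

Lemma ldetE m h : 'X^(N.+1) * ldet m h = h * lrem m - m * lrem h.
Proof.
have Eh : lrem h = h * Y - lquo h * 'X^(N.+1) by rewrite lquo_rem addrC addKr.
have Em : lrem m = m * Y - lquo m * 'X^(N.+1) by rewrite lquo_rem addrC addKr.
rewrite Eh Em /ldet; ring.
Qed.

(** By [ldetE], t^(N+1) times the determinant is a difference of two products, each of size at most
    [R + lnorm m]. *)
Lemma size_ldet m h R : (lnorm h <= R)%N ->
  (size (ldet m h) <= R + lnorm m - N.+1)%N.
Proof.
move=> hR; have [->|w0] := eqVneq (ldet m h) 0; first by rewrite size_poly0.
have := leq_size_sub (h * lrem m) (m * lrem h); rewrite -ldetE.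
rewrite size_mul ?size_polyXn //; last by rewrite -size_poly_gt0 size_polyXn.
move: hR; rewrite /lnorm !geq_max => /andP[h1 h2].
have := leq_size_mul h (lrem m); have := leq_size_mul m (lrem h); size_lia.
Qed.

Lemma lattice_min : exists2 m, m != 0 & forall h, h != 0 -> (lnorm m <= lnorm h)%N.
Proof.
suff H k : (exists2 h, h != 0 & (lnorm h < k)%N) ->
    exists2 m, m != 0 & forall h, h != 0 -> (lnorm m <= lnorm h)%N.
  by apply: (H (lnorm 1).+1); exists 1; rewrite ?oner_neq0.
elim: k => [|k IHk] [h h0 hk] //.
have [|noh] := EM (exists2 h, h != 0 & (lnorm h < k)%N); first exact: IHk.
exists h => // g g0; rewrite leqNgt; apply/negP=> gh; apply: noh.
by exists g => //; apply: leq_trans gh hk.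
Qed.

Variable m : {poly F}.
Hypotheses (m0 : m != 0) (m_min : forall h, h != 0 -> (lnorm m <= lnorm h)%N).

(* The lattice vectors parallel to a shortest one are its polynomial multiples. *)
Lemma ldet0P h : ldet m h = 0 -> exists2 c, h = c * m & lquo h = c * lquo m.
Proof.
move=> w0; have E : h * lrem m = m * lrem h.
  by apply/eqP; rewrite -subr_eq0 -ldetE w0 mulr0.
(* The remainder [r] is again the first coordinate of a vector parallel to [(m, lrem m)], with
   second coordinate [k]. Its degree is smaller, so it would be strictly shorter unless [r = 0]. *)
have Eh := divp_eq h m; set c := h %/ m in Eh; set r := h %% m in Eh.
have sr : (size r < size m)%N by rewrite ltn_modp.
pose k := lrem h - c * lrem m.
have rY : r * Y = (lquo h - c * lquo m) * 'X^(N.+1) + k.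
  have -> : r = h - c * m by rewrite Eh addrC addKr.
  have -> : (h - c * m) * Y = h * Y - c * (m * Y) by ring.
  by rewrite (lquo_rem h) (lquo_rem m) /k; ring.
have rk : r * lrem m = m * k.
  have -> : r = h - c * m by rewrite Eh addrC addKr.
  by rewrite mulrBl E /k; ring.
have sk : (size k <= size (lrem m))%N /\
    (lrem m != 0 -> r != 0 -> (size k < size (lrem m))%N).
  have [k0|k0] := eqVneq k 0.
    by rewrite k0 size_poly0; split=> // s0 _; rewrite size_poly_gt0.
  have r0 : r != 0.
    by apply: contraNneq k0 => r0; move/eqP: rk; rewrite r0 mul0r eq_sym mulf_eq0 (negPf m0).
  have s0 : lrem m != 0.
    by apply: contraNneq k0 => s0; move/eqP: rk; rewrite s0 mulr0 eq_sym mulf_eq0 (negPf m0).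
  have /(congr1 (fun p : {poly F} => size p)) := rk.
  rewrite !size_mul //; have: (0 < size r)%N by rewrite size_poly_gt0.
  have: (0 < size (lrem m))%N by rewrite size_poly_gt0.
  by move=> s1 r1 e; split=> *; size_lia.
have [qr kr] := lquo_remE rY (leq_trans sk.1 (size_lrem m)).
have r0 : r = 0.
  apply/eqP; apply/negPn/negP=> r0; have := m_min r0; rewrite /lnorm kr.
  have: (0 < size r)%N by rewrite size_poly_gt0.
  have [s0|s0] := eqVneq (lrem m) 0.
    have := sk.1; rewrite s0 size_poly0; size_lia.
  have := sk.2 s0 r0; have: (0 < size (lrem m))%N by rewrite size_poly_gt0.
  size_lia.
exists c; first by rewrite {1}Eh r0 addr0.
by apply/eqP; rewrite -subr_eq0 -qr r0 /lquo mul0r div0p.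
Qed.

(** A nonzero [c] multiplies both coordinates, hence adds [(size c).-1] to the norm. *)
Lemma size_multiple R h c : h = c * m -> lquo h = c * lquo m ->
  (lnorm h <= R)%N -> (size c <= R.+1 - lnorm m)%N.
Proof.
move=> Eh Eq; have [->|c0] := eqVneq c 0; first by rewrite size_poly0.
have Er : lrem h = c * lrem m.
  have := lquo_rem h; rewrite Eq Eh -mulrA (lquo_rem m) mulrDr mulrA.
  by move/addrI.
rewrite /lnorm Er Eh geq_max size_mul // => /andP[].
have: (0 < size c)%N by rewrite size_poly_gt0.
have: (0 < size m)%N by rewrite size_poly_gt0.
have [->|s0] := eqVneq (lrem m) 0; first by rewrite mulr0 size_poly0; size_lia.
rewrite size_mul //; have: (0 < size (lrem m))%N by rewrite size_poly_gt0.
size_lia.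
Qed.

(* [ldet m] is linear with small values, and its fibres are translates of multiples
   of [m]. *)
Lemma card_lattice_box (I : finType) (A : {set I}) (psi : I -> {poly F}) R :
  {in A &, injective psi} -> {in A, forall x, lnorm (psi x) <= R}%N ->
  (#|A| <= #|F| ^ ((R + lnorm m - N.+1) + (R.+1 - lnorm m)))%N.
Proof.
move=> injA RA; rewrite expnD.
apply: (leq_card_poly_fibers (phi := fun x => ldet m (psi x))) => x Ax.
  by apply: size_ldet; apply: RA.
apply: (leq_card_multiples (psi := psi) (m := m) (g := 1)) => //.
- exact: oner_neq0.
- by move=> y z; rewrite !inE => /andP[Ay _] /andP[Az _]; apply: injA.
move=> y z; rewrite !inE => /andP[Ay /eqP wy] /andP[Az /eqP wz].
have [|c Ec Eq] := @ldet0P (psi y - psi z); first by rewrite ldetB wy wz subrr.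
exists c; last by rewrite mul1r.
by apply: size_multiple Ec Eq _; apply: lnormB; apply: RA.
Qed.

End Lattice.

(** * Squares near a given point *)

Section Squares.

Variables (F : finFieldType) (N : nat) (Y : {poly F}) (n : nat).

(* The [f] of degree [n] such that [f^2 Y / t^(N+1)] is close to a polynomial prime
   to [f], namely [lquo (f^2)]. *)
Definition near_squares : {set {poly_n.+1 F}} :=
  [set f : {poly_n.+1 F} | [&& size f == n.+1, coprimep (lquo N Y ((f : {poly F}) ^+ 2)) f
    & (size (lrem N Y ((f : {poly F}) ^+ 2)) <= 2 * n)%N]].

Local Notation sq f := ((f : {poly F}) ^+ 2).
Local Notation lnorm := (lnorm N Y).
Local Notation ldet := (ldet N Y).

Lemma lnorm_square (f : {poly_n.+1 F}) : f \in near_squares -> (lnorm (sq f) <= 2 * n)%N.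
Proof.
rewrite inE => /and3P[/eqP sf _ sr]; rewrite /lnorm geq_max sr andbT expr2.
by have := leq_size_mul f f; size_lia.
Qed.

Hypothesis two_unit : (2 : F) != 0.

Lemma eq_double (f g : {poly F}) : f + f = g + g -> f = g.
Proof.
rewrite -!mulr2n -!scaler_nat => /(congr1 (fun p => (2 : F)^-1 *: p)).
by rewrite !scalerA mulVf // !scale1r.
Qed.

Lemma card_same_square (A : {set {poly_n.+1 F}}) :
  {in A &, forall f g : {poly_n.+1 F}, sq f = sq g} -> (#|A| <= 2)%N.
Proof.
have [->|[f Af] sqA] := set_0Vmem A; first by rewrite cards0.
apply: leq_trans (subset_leq_card (B := [set f; - f]) _) _; last first.
  by rewrite cards2; case: (_ != _).
apply/subsetP=> g Ag; rewrite !inE; have := sqA g f Ag Af.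
move/eqP; rewrite eqf_sqr => /orP[] /eqP E; apply/orP; [left|right]; apply/eqP.
  exact: val_inj.
exact: val_inj.
Qed.

Variable m : {poly F}.
Hypotheses (m0 : m != 0)
  (m_min : forall h : {poly F}, h != 0 -> (lnorm m <= lnorm h)%N).

(* If [sq f = c * m] then [c] also divides [lquo (sq f)], which is coprime to [f]. *)
Lemma card_det0_near_squares :
  (#|[set f in near_squares | ldet m (sq f) == 0%R]| <= #|F| * 2)%N.
Proof.
rewrite -{1}[#|F|]expn1.
have H (f : {poly_n.+1 F}) : f \in [set f in near_squares | ldet m (sq f) == 0%R] ->
    exists2 c : {poly F}, (size c <= 1)%N & sq f = c * m.
  rewrite inE => /andP[Sf /eqP /(ldet0P m0 m_min)[c Ec Eq]].
  move: Sf; rewrite inE Eq => /and3P[/eqP sf cop _]; exists c => //.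
  have cf : coprimep c f by apply: coprimep_dvdr cop; rewrite dvdp_mulr.
  suff /eqP-> : size c == 1%N by [].
  rewrite -coprimepp; apply: (coprimep_dvdl _ (coprimep_expr 2 cf)).
  by rewrite Ec dvdp_mulr.
apply: (leq_card_poly_fibers (phi := fun f : {poly_n.+1 F} => sq f %/ m)) => f Af.
  by have [c sc ->] := H f Af; rewrite mulpK.
apply: card_same_square => g h /setIdP[/H[c _ Ec] /eqP Eg] /setIdP[/H[d _ Ed] /eqP Eh].
have : sq g %/ m = sq h %/ m by rewrite Eg Eh.
by rewrite Ec Ed !mulpK // => ->.
Qed.

(** Pairs are sorted by [h = f^2 - g^2]. A nonzero [h] lies in a lattice box and its divisor [f - g]
    determines the pair; [h = 0] leaves at most two choices of [g] for each [f]. *)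
Lemma card_pairs_near_squares :
  (#|near_squares| ^ 2 <= #|F| ^ ((2 * n + lnorm m - N.+1) + ((2 * n).+1 - lnorm m))
     * (#|F| * 2 ^ (2 * n)) + 2 * #|near_squares|)%N.
Proof.
set S := near_squares; pose D := setX S S.
pose phi (x : {poly_n.+1 F} * {poly_n.+1 F}) : {poly F} := sq x.1 - sq x.2.
have -> : (#|S| ^ 2 = #|D|)%N by rewrite cardsX.
have -> : D = [set x in D | phi x != 0%R] :|: [set x in D | phi x == 0%R].
  by apply/setP=> x; rewrite !inE -andb_orr orNb andbT.
apply: leq_trans (leq_card_setU _ _) _; apply: leq_add; last first.
  rewrite mulnC [#|S|]cardE.
  apply: (leq_card_fibers (phi := fun x : {poly_n.+1 F} * {poly_n.+1 F} => x.1)).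
    by move=> [a b] /setIdP[/setXP[Sa _] _]; rewrite mem_enum.
  move=> x _; rewrite -(card_in_imset (f := fun x => x.2)); last first.
    by move=> [a b] [c d] /setIdP[_ /eqP/= ->] /setIdP[_ /eqP/= ->] /= ->.
  apply: card_same_square => f g /imsetP[[a b] + /= ->] /imsetP[[c d] + /= ->].
  move=> /setIdP[/setIdP[_ E1] /eqP/= a1] /setIdP[/setIdP[_ E2] /eqP/= a2].
  by move: E1 E2; rewrite /phi /= a1 a2 !subr_eq0 => /eqP <- /eqP <-.
pose L := [set h : {poly_(2 * n).+1 F} | (lnorm h <= 2 * n)%N].
have SD x : x \in D -> (lnorm (phi x) <= 2 * n)%N.
  by case: x => a b /setXP[Sa Sb]; apply: lnormB; apply: lnorm_square.
have LL : (#|L| <= #|F| ^ ((2 * n + lnorm m - N.+1) + ((2 * n).+1 - lnorm m)))%N.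
  apply: (card_lattice_box (psi := fun h : {poly_(2 * n).+1 F} => (h : {poly F})) m0 m_min).
    by move=> h h' _ _; apply: val_inj.
  by move=> h; rewrite inE.
apply: leq_trans (leq_mul LL (leqnn _)).
rewrite -(size_image (fun h : {poly_(2 * n).+1 F} => (h : {poly F})) L).
apply: (leq_card_fibers (phi := phi)) => x /setIdP[Dx phix].
  have szx : (size (phi x) <= (2 * n).+1)%N.
    by have := SD x Dx; rewrite /lnorm geq_max => /andP[+ _]; size_lia.
  apply/imageP; exists (npolyp _ (phi x)); last by rewrite npolypK.
  by rewrite inE npolypK // SD.
have szx : ((size (phi x)).-1 <= 2 * n)%N.
  by have := SD x Dx; rewrite /lnorm geq_max => /andP[].
have [s ss sP] := poly_divisors phix.
have -> : (#|F| * 2 ^ (2 * n) = #|F| * 2 ^ (2 * n) * 1)%N by rewrite muln1.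
apply: leq_trans (leq_mul (leq_trans ss _) (leqnn 1)); last first.
  by rewrite leq_mul2l leq_exp2l // szx orbT.
have phiE y : phi y = ((y.1 : {poly F}) - y.2) * ((y.1 : {poly F}) + y.2).
  by rewrite /phi subr_sqr.
apply: (leq_card_fibers (phi := fun y : {poly_n.+1 F} * {poly_n.+1 F} =>
    (y.1 : {poly F}) - y.2)) => y /setIdP[_ /eqP Ey].
  by apply: sP; rewrite -Ey phiE dvdp_mulr.
apply: leq_trans (subset_leq_card (B := [set y]) _) _; last by rewrite cards1.
apply/subsetP=> z /setIdP[/setIdP[_ /eqP Ez] /eqP zy]; rewrite inE.
(* The nonzero difference can be cancelled from [phi y], so sum and difference of the entries are
   both known, and 2 is invertible. *)
have d0 : (y.1 : {poly F}) - y.2 != 0.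
  by apply: contraNneq phix => d0; rewrite -Ey phiE d0 mul0r.
have zy' : (z.1 : {poly F}) + z.2 = (y.1 : {poly F}) + y.2.
  by apply: (mulfI d0); rewrite -phiE Ey -{1}zy -phiE Ez.
have Ez1 : (z.1 : {poly F}) = y.1.
  apply: eq_double.
  have -> : (z.1 : {poly F}) + z.1 =
      ((z.1 : {poly F}) - z.2) + ((z.1 : {poly F}) + z.2) by ring.
  by rewrite zy zy'; ring.
have Ez2 : (z.2 : {poly F}) = y.2 by move: zy'; rewrite Ez1 => /addrI.
by rewrite [z]surjective_pairing [y]surjective_pairing (val_inj Ez1) (val_inj Ez2).
Qed.

Lemma size_double (f : {poly F}) : size (f + f) = size f.
Proof. by rewrite -mulr2n -scaler_nat size_scale. Qed.

(** Equal determinants make [f^2 - g^2] a multiple [c * m] with [c] of bounded degree. Since [2f] is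
    the sum of [f - g] and [f + g], one of these has degree at least [n], which forces the other to
    be small. *)
Lemma same_det_size (f g : {poly_n.+1 F}) : f \in near_squares -> g \in near_squares ->
  ldet m (sq f) = ldet m (sq g) ->
  m %| ((f : {poly F}) - g) * ((f : {poly F}) + g) /\
  ((size ((f : {poly F}) - g)%R <= n + size m - lnorm m)%N \/
   (size ((f : {poly F}) + g)%R <= n + size m - lnorm m)%N).
Proof.
move=> Sf Sg w_fg; set x := _ - _; set y := (f : {poly F}) + g.
have Exy : sq f - sq g = x * y by rewrite subr_sqr.
have [|c Ec Eq] := @ldet0P _ N Y m m0 m_min (sq f - sq g).
  by rewrite ldetB w_fg subrr.
have sc : (size c <= (2 * n).+1 - lnorm m)%N.
  by apply: (size_multiple m0 Ec Eq); apply: lnormB; apply: lnorm_square.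
split; first by rewrite -Exy Ec dvdp_mull.
have [->|x0] := eqVneq x 0; first by left; rewrite size_poly0.
have [->|y0] := eqVneq y 0; first by right; rewrite size_poly0.
have xy : size (x * y) = size (c * m) by rewrite -Exy Ec.
have c0 : c != 0.
  apply/negP=> /eqP c0; move/eqP: xy.
  by rewrite c0 mul0r size_poly0 size_poly_eq0 mulf_eq0 (negPf x0) (negPf y0).
rewrite !size_mul // in xy.
have sx : (0 < size x)%N by rewrite size_poly_gt0.
have sy : (0 < size y)%N by rewrite size_poly_gt0.
have sc0 : (0 < size c)%N by rewrite size_poly_gt0.
have sm0 : (0 < size m)%N by rewrite size_poly_gt0.
have sf : size f = n.+1 by move: Sf; rewrite inE => /and3P[/eqP].
have : (n.+1 <= maxn (size x) (size y))%N.
  rewrite -sf -size_double -[size y]size_polyN.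
  have -> : (f : {poly F}) + f = x - - y by rewrite /x /y; ring.
  by have := leq_size_sub x (- y).
by move=> ?; apply/orP; move: xy sx sy sc sc0 sm0; size_lia.
Qed.

Hypothesis m_small : (lnorm m <= n)%N.

(* If [f1] has the same determinant [w] as [f], put [u = gcd (m, f - f1)] and
   [v = m / u]; then [v] divides [f + f1], so [u] and [w] determine [f] modulo
   [lcm (u, v) = m / g], where [g = gcd (u, v)] divides [w]. Thus the factor [q ^ deg g]
   lost in counting [f] is regained in counting [w]. *)
Lemma card_det_neq0_near_squares :
  (#|[set f in near_squares | ldet m (sq f) != 0%R]|
    <= (2 * #|F| * 2 ^ n) * #|F| ^ (3 * n - N))%N.
Proof.
set S := [set f in _ | _].
(* This fixes one [f1] for each determinant; the default [0] is never reached at determinants of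
   elements of [S]. *)
pose rep (w : {poly F}) : {poly_n.+1 F} := odflt 0 [pick f in S | ldet m (sq f) == w].
have repP f : f \in S -> rep (ldet m (sq f)) \in S /\
    ldet m (sq (rep (ldet m (sq f)))) = ldet m (sq f).
  move=> Sf; rewrite /rep; case: pickP => [g /andP[Sg /eqP]//|/(_ f)].
  by rewrite Sf eqxx.
pose r f := rep (ldet m (sq f)).
have SS f : f \in S -> f \in near_squares by case/setIdP.
have rP f (Sf : f \in S) := same_det_size (SS _ Sf) (SS _ (repP _ Sf).1) (esym (repP _ Sf).2).
pose l := (n + size m - lnorm m)%N.
have [s ss sP] := poly_divisors m0.
(* The class of [f] records whether [f - r f] is the small factor, together with the divisor [u] of
   [m]. *)
pose phi (f : {poly_n.+1 F}) :=
  ((size ((f : {poly F}) - r f)%R <= l)%N, gcdp m ((f : {poly F}) - r f)).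
have sm : ((size m).-1 <= lnorm m)%N by rewrite /lnorm leq_maxl.
have ss2 : (size (allpairs pair [:: true; false] s) <= 2 * #|F| * 2 ^ n)%N.
  rewrite size_allpairs -mulnA leq_mul2l (leq_trans ss) // leq_mul2l.
  by rewrite leq_exp2l // (leq_trans sm) // orbT.
apply: leq_trans (leq_mul ss2 (leqnn _)).
apply: (leq_card_fibers (phi := phi)) => f Sf.
  apply/allpairsP; exists (phi f); rewrite -surjective_pairing; split=> //.
    by rewrite !inE; case: (phi f).1.
  by apply: sP; rewrite dvdp_gcdl.
set u := (phi f).2; set B := [set _ in _ | _].
have um : u %| m by rewrite dvdp_gcdl.
have u0 : u != 0 by apply: contraNneq m0 => u0; rewrite u0 dvd0p in um.
pose v := m %/ u.
have Em : m = v * u by rewrite divpK.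
pose g := gcdp u v.
have g0 : g != 0 by rewrite gcdp_eq0 negb_and u0.
have sg0 : (0 < size g)%N by rewrite size_poly_gt0.
have sm0 : (0 < size m)%N by rewrite size_poly_gt0.
have uv h : h \in B -> u %| (h : {poly F}) - r h /\ v %| (h : {poly F}) + r h.
  case/setIdP=> Sh /eqP Eh; have Eu : u = gcdp m ((h : {poly F}) - r h) by rewrite /u -Eh.
  split; first by rewrite Eu dvdp_gcdr.
  have [mh _] := rP h Sh.
  (* Once the gcd [u] is removed, [v] is prime to the cofactor of [h - r h], so it must divide
     [h + r h]. *)
  have co : coprimep v (((h : {poly F}) - r h) %/ u).
    by rewrite /v {1 2}Eu coprimep_div_gcd // m0.
  rewrite -(Gauss_dvdpr _ co) -(dvdp_mul2r _ _ u0) -Em mulrAC divpK //.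
  by rewrite Eu dvdp_gcdr.
have gw h : h \in B -> g %| ldet m (sq h).
  move=> Bh; have [uh vh] := uv h Bh.
  have gh : g %| h.
    have : g %| (h : {poly F}) + h.
      have -> : (h : {poly F}) + h = (h - r h : {poly F}) + (h + r h : {poly F}) by ring.
      by rewrite dvdp_add // (dvdp_trans _ uh, dvdp_trans _ vh) ?dvdp_gcdl ?dvdp_gcdr.
    by rewrite -mulr2n -scaler_nat dvdpZr.
  rewrite /ldet dvdp_sub //; last by rewrite expr2 -mulrA dvdp_mulr.
  by rewrite dvdp_mull // (dvdp_trans _ um) // dvdp_gcdl.
pose e := (2 * n + lnorm m - N.+1)%N.
have we h : h \in B -> (size g <= size (ldet m (sq h)) <= e)%N.
  move=> Bh; have /setIdP[/setIdP[Sh w0] _] := Bh.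
  by rewrite dvdp_leq ?gw //= size_ldet ?lnorm_square.
have [->|[h0 Bh0]] := set_0Vmem B; first by rewrite cards0.
have ge := we _ Bh0.
(* The exponent saved by dividing the determinants by [g] is the one lost in each fibre, so the
   total does not depend on [g]. *)
have -> : (3 * n - N = (e - (size g).-1) + (size g + n - lnorm m))%N.
  by have /andP[g1 g2] := ge; move: (leq_trans g1 g2) sg0 m_small; rewrite /e; clear; size_lia.
rewrite expnD; apply: (leq_card_poly_fibers (phi := fun h : {poly_n.+1 F} => ldet m (sq h) %/ g)).
  by move=> h Bh; rewrite size_divp // leq_sub2r //; case/andP: (we h Bh).
move=> h Bh; apply: (leq_card_multiples (psi := fun f : {poly_n.+1 F} => (f : {poly F})) m0 g0).
  by move=> ? ? _ _; apply: val_inj.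
have key x : x \in [set k in B | ldet m (sq k) %/ g == ldet m (sq h) %/ g] ->
    x \in B /\ ldet m (sq x) = ldet m (sq h).
  case/setIdP=> Bx /eqP E; split=> //.
  by rewrite -(divpK (gw _ Bx)) E divpK // gw.
move=> x y /key[Bx wx] /key[By wy].
have rxy : r x = r y by rewrite /r wx wy.
have [ux vx] := uv x Bx; have [uy vy] := uv y By.
have udiv : u %| (x : {poly F}) - y.
  have -> : (x : {poly F}) - y = (x - r x : {poly F}) - (y - r y : {poly F}).
    by rewrite rxy; ring.
  exact: dvdp_sub.
have vdiv : v %| (x : {poly F}) - y.
  have -> : (x : {poly F}) - y = (x + r x : {poly F}) - (y + r y : {poly F}).
    by rewrite rxy; ring.
  exact: dvdp_sub.
(* [g * (x - y)] is, up to a unit, the gcd of [u * (x - y)] and [v * (x - y)], both multiples of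
   [u * v = m]. *)
have mdiv : m %| g * ((x : {poly F}) - y).
  rewrite mulrC (eqp_dvdr _ (mulp_gcdr _ _ _)) dvdp_gcd Em.
  by apply/andP; split; [|rewrite [v * u]mulrC]; apply: dvdp_mul.
(* The recorded alternative is common to [x] and [y], so [x - y] is a difference of two small
   polynomials. *)
have sxy : (size ((x : {poly F}) - y)%R <= l)%N.
  have side z : z \in B -> ((size ((z : {poly F}) - r z)%R <= l)%N = (phi f).1).
    by case/setIdP=> _ /eqP <-.
  have side' z (Bz : z \in B) : ~~ (phi f).1 -> (size ((z : {poly F}) + r z)%R <= l)%N.
    rewrite -(side z Bz); have /setIdP[Sz _] := Bz.
    by case: (rP z Sz) => _ [->|].
  have [b|b] := boolP (phi f).1.
    have -> : (x : {poly F}) - y = (x - r x : {poly F}) - (y - r y : {poly F}).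
      by rewrite rxy; ring.
    by apply: leq_trans (leq_size_sub _ _) _; rewrite geq_max (side x Bx) (side y By) b.
  have -> : (x : {poly F}) - y = (x + r x : {poly F}) - (y + r y : {poly F}).
    by rewrite rxy; ring.
  by apply: leq_trans (leq_size_sub _ _) _; rewrite geq_max (side' x Bx b) (side' y By b).
exists ((g * ((x : {poly F}) - y)) %/ m); last by rewrite divpK.
rewrite size_divp //; apply: leq_trans (leq_sub2r _ (leq_size_mul _ _)) _.
by move: sxy m_small sg0 sm0; rewrite /l; clear; size_lia.
Qed.

Lemma card_near_squares_small :
  (#|near_squares| <= 2 * #|F| + (2 * #|F| * 2 ^ n) * #|F| ^ (3 * n - N))%N.
Proof.
have -> : near_squares = [set f in near_squares | ldet m (sq f) == 0%R]
    :|: [set f in near_squares | ldet m (sq f) != 0%R].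
  by apply/setP=> f; rewrite in_setU [in RHS]in_set [X in _ || X]in_set -andb_orr orbN andbT.
apply: leq_trans (leq_card_setU _ _) _; apply: leq_add; last exact: card_det_neq0_near_squares.
by rewrite mulnC; exact: card_det0_near_squares.
Qed.

End Squares.

(** * Duality for Hankel matrices *)

(** A matrix and its transpose have the same rank [r], so their kernels have [q^(a - r)] and
    [q^(b - r)] elements. *)
Lemma card_ker_tr (F : finFieldType) (a b : nat) (A : 'M[F]_(a, b)) :
  (#|F| ^ b * #|[set v : 'rV[F]_a | v *m A == 0%R]|
   = #|F| ^ a * #|[set v : 'rV[F]_b | v *m A^T == 0%R]|)%N.
Proof.
have H c d (B : 'M[F]_(c, d)) : #|[set v : 'rV[F]_c | v *m B == 0]| = (#|F| ^ (c - \rank B))%N.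
  rewrite -mxrank_ker -card_rowg; apply: eq_card => v; rewrite inE mem_rowg.
  by apply/eqP/sub_kermxP.
rewrite !H mxrank_tr -!expnD; congr (_ ^ _)%N.
by have := rank_leq_row A; have := rank_leq_col A; lia.
Qed.

Section Duality.
Variables (F : finFieldType) (N : nat).

Lemma size_modXn (Z : {poly F}) k :
  (size (Z %% 'X^(N.+1))%R <= k)%N = [forall i : 'I_N.+1, (k <= i)%N ==> (Z`_i == 0)].
Proof.
have co i : (i < N.+1)%N -> (Z %% 'X^(N.+1))`_i = Z`_i.
  by move=> iN; rewrite [in RHS](divp_eq Z 'X^(N.+1)) coefD coefMXn iN add0r.
apply/idP/forallP => [sZ i|HZ].
  by apply/implyP=> ki; rewrite -co // nth_default // (leq_trans sZ).
apply/leq_sizeP => i ki; have [iN|iN] := ltnP i N.+1.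
  by rewrite co //; have /implyP/(_ ki)/eqP := HZ (Ordinal iN).
rewrite nth_default // (leq_trans _ iN) // -ltnS -(size_polyXn F N.+1).
by rewrite ltn_modp -size_poly_gt0 size_polyXn.
Qed.

(* The matrix with entries [Z_(N - i - k)] is symmetric, so its left and right kernels
   have the same description. *)
Lemma card_size_mod (Z : {poly F}) a b : (a <= N.+1)%N -> (b <= N.+1)%N ->
  (#|F| ^ b * #|[set v : {poly_a F} |
       (size (((v : {poly F}) * Z) %% 'X^(N.+1))%R <= N.+1 - b)%N]|
   = #|F| ^ a * #|[set v : {poly_b F} |
       (size (((v : {poly F}) * Z) %% 'X^(N.+1))%R <= N.+1 - a)%N]|)%N.
Proof.
move=> aN bN.
pose A c d := \matrix_(i < c, k < d) (('X^i * 'X^k * Z)`_N : F).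
(* A remainder of size at most [N.+1 - d] means that the coefficients of degree [N - k], [k < d],
   vanish: one column of [A c d] for each [k]. *)
have H c d : (d <= N.+1)%N ->
    #|[set v : {poly_c F} | (size (((v : {poly F}) * Z) %% 'X^(N.+1))%R <= N.+1 - d)%N]|
    = #|[set v : 'rV[F]_c | v *m A c d == 0%R]|.
  move=> dN; rewrite -(card_imset _ (can_inj (@npoly_rV_K F c))).
  apply: eq_card => v; rewrite [RHS]inE.
  have -> : (v \in [set npoly_rV x | x in [set v : {poly_c F} |
        (size (((v : {poly F}) * Z) %% 'X^(N.+1))%R <= N.+1 - d)%N]]) =
     (size ((rVpoly v * Z) %% 'X^(N.+1))%R <= N.+1 - d)%N.
    have E : (rVnpoly v : {poly F}) = rVpoly v by rewrite /= val_insubd [_ \is a _]size_poly.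
    apply/imsetP/idP => [[x + ->]|sv].
      by rewrite inE; rewrite -{1}[x]npoly_rV_K /= val_insubd [_ \is a _]size_poly.
    by exists (rVnpoly v); rewrite ?rVnpolyK // inE E.
  have coE k : (k <= N)%N ->
      (v *m (\col_i (('X^i * 'X^k * Z)`_N : F))) 0 0 = (rVpoly v * Z)`_(N - k).
    move=> kN; rewrite mxE.
    transitivity (('X^k * (rVpoly v * Z))`_N); last by rewrite coefXnM ltnNge kN.
    have -> : rVpoly v = \sum_(i < c) v 0 i *: 'X^i.
      rewrite /rVpoly poly_def; apply: eq_bigr => i _; congr (_ *: _).
      by case: insubP => [j _ ij|]; [congr (v 0 _); apply: val_inj | rewrite ltn_ord].
    rewrite mulr_suml mulr_sumr coef_sum; apply: eq_bigr => i _; rewrite !mxE.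
    by rewrite -!scalerAl -!scalerAr coefZ mulrA ['X^k * 'X^i]mulrC.
  rewrite size_modXn; apply/forallP/eqP => [Hv|Hv i].
    apply/rowP=> k; rewrite !mxE.
    have kN : (k <= N)%N by have := ltn_ord k; lia.
    have iN : (N - k < N.+1)%N by lia.
    have /implyP/= Hk := Hv (Ordinal iN).
    have /eqP : (rVpoly v * Z)`_(N - k) == 0 by apply: Hk; have := ltn_ord k; lia.
    rewrite -(coE k kN) mxE => E; rewrite -[RHS]E.
    by apply: eq_bigr => j _; rewrite !mxE.
  apply/implyP=> iN; have kd : (N - i < d)%N by have := ltn_ord i; lia.
  have -> : (rVpoly v * Z)`_i = (rVpoly v * Z)`_(N - (N - i)).
    by congr (_`_ _); have := ltn_ord i; lia.
  rewrite -coE ?leq_subr //; move/rowP/(_ (Ordinal kd)): Hv; rewrite !mxE => Hv.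
  by rewrite -[X in _ == X]Hv; apply/eqP/eq_bigr => j _; rewrite !mxE.
rewrite !H // card_ker_tr; congr (_ * _)%N.
congr #|pred_of_set _|; apply/setP=> v; rewrite !inE; congr (_ *m _ == 0).
by apply/matrixP=> i k; rewrite !mxE ['X^i * _]mulrC.
Qed.

End Duality.

(** * Variance of the leading coefficients of squares *)

(** The right side is the sum over all fibres of the squared deviation from the mean size; the left
    side is its term at [z]. *)
Lemma second_moment (R : realFieldType) (I J : finType) (phi : I -> J) (z : J) :
  (#|[set x | phi x == z]|%:R - #|I|%:R / #|J|%:R) ^+ 2 <=
  #|[set x : I * I | phi x.1 == phi x.2]|%:R - #|I|%:R ^+ 2 / #|J|%:R :> R.
Proof.
pose M y : R := #|[set x | phi x == y]|%:R; pose mu : R := #|I|%:R / #|J|%:R.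
have J0 : (#|J|%:R : R) != 0 by rewrite pnatr_eq0 -lt0n; apply/card_gt0P; exists z.
have sM : \sum_y M y = #|I|%:R.
  rewrite /M -natr_sum -sum1_card (partition_big phi predT) //=.
  by congr (_%:R); apply: eq_bigr => y _; rewrite sum1_card; apply: eq_card => x; rewrite !inE.
have sM2 : \sum_y M y ^+ 2 = #|[set x : I * I | phi x.1 == phi x.2]|%:R.
  rewrite -[in RHS]sum1_card (partition_big (fun x => phi x.1) predT) //= natr_sum.
  apply: eq_bigr => y _; rewrite sum1_card /M -natrX -mulnn -cardsX; congr (_%:R).
  apply: eq_card => -[a b]; rewrite [RHS]unfold_in /= !inE /=.
  by apply/andP/andP => -[/eqP E1 /eqP E2]; rewrite ?E1 ?E2 -?E1 ?E2 eqxx.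
have -> : #|[set x : I * I | phi x.1 == phi x.2]|%:R - #|I|%:R ^+ 2 / #|J|%:R
    = \sum_y (M y - mu) ^+ 2.
  have E y : (M y - mu) ^+ 2 = M y ^+ 2 + (- (2 * mu) * M y + mu ^+ 2) by ring.
  rewrite (eq_bigr _ (fun y _ => E y)) big_split big_split /= sM2 -mulr_sumr sM.
  by rewrite sumr_const -mulr_natr /mu; field.
by rewrite (bigD1 z) //= lerDl sumr_ge0 // => y _; rewrite sqr_ge0.
Qed.

Section Variance.

Variables (F : finFieldType) (N : nat) (Y : {poly F}) (n : nat).
Hypothesis two_unit : (2 : F) != 0.
Hypothesis nN : (2 * n <= N)%N.
Local Notation near_squares := (near_squares N Y n).
Local Notation sq f := ((f : {poly F}) ^+ 2).
Local Notation lnorm := (lnorm N Y).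
Local Notation lrem := (lrem N Y).
Variable m : {poly F}.
Hypotheses (m0 : m != 0)
  (m_min : forall h : {poly F}, h != 0 -> (lnorm m <= lnorm h)%N).
Hypothesis m_large : (n < lnorm m)%N.
Local Notation c := (N.+1 - 2 * n)%N.

(** A product [u * l] has degree at most [n + c - 1 = N - n], so it lies in the lattice box of
    radius [N - n]. Each nonzero product has few divisors [u]; the first two terms count the zero
    products. *)
Lemma card_small_products :
  (#|[set x : {poly_n.+1 F} * {poly_c F} |
      (size (lrem ((x.1 : {poly F}) * x.2)) <= N - n)%N]|
   <= #|F| ^ n.+1 + #|F| ^ c + #|F| ^ (N - 2 * n) * (#|F| * 2 ^ (N - n)))%N.
Proof.
set D := [set x | _].
pose phi (x : {poly_n.+1 F} * {poly_c F}) : {poly F} := (x.1 : {poly F}) * x.2.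
pose D1 := [set x in D | phi x != 0].
have DU : D \subset [set (u, 0) | u : {poly_n.+1 F}] :|: [set (0, l) | l : {poly_c F}] :|: D1.
  apply/subsetP=> -[u l] Dx; rewrite /D1 !in_setU in_set Dx /=.
  rewrite /phi /= mulf_eq0 negb_or; have [/eqP u0|u0] := boolP ((u : {poly F}) == 0).
    by have -> : u = 0 by [apply: val_inj]; rewrite imset_f ?orbT.
  have [/eqP l0|l0] := boolP ((l : {poly F}) == 0); last by rewrite orbT.
  by have -> : l = 0 by [apply: val_inj]; rewrite imset_f.
apply: leq_trans (subset_leq_card DU) _.
apply: leq_trans (leq_card_setU _ _) _; apply: leq_add.
  apply: leq_trans (leq_card_setU _ _) _; apply: leq_add.
    by rewrite (leq_trans (leq_imset_card _ _)) // card_npoly.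
  by rewrite (leq_trans (leq_imset_card _ _)) // card_npoly.
have sphi x : x \in D -> (lnorm (phi x) <= N - n)%N.
  rewrite inE => sD; rewrite /lnorm geq_max sD andbT.
  have : (size (phi x) <= (N - n).+1)%N.
    apply: leq_trans (leq_size_mul _ _) _.
    have E : (n.+1 + c).-1 = (N - n).+1 by move: nN; clear; lia.
    by rewrite -E -!subn1 leq_sub2r // leq_add ?size_npoly.
  by clear; size_lia.
have [->|[x0 Dx0]] := set_0Vmem D1; first by rewrite cards0.
have mN : (lnorm m <= N - n)%N.
  by have /setIdP[Dx ph] := Dx0; apply: leq_trans (sphi _ Dx); apply: m_min.
pose L := [set h : {poly_(N - n).+1 F} | (lnorm h <= N - n)%N].
have LL : (#|L| <= #|F| ^ (N - 2 * n))%N.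
  (* As [n < lnorm m <= N - n], no subtraction is truncated and [lnorm m] cancels. *)
  have -> : (N - 2 * n = (N - n + lnorm m - N.+1) + ((N - n).+1 - lnorm m))%N.
    by move: mN m_large nN; clear; lia.
  apply: (card_lattice_box (psi := fun h : {poly_(N - n).+1 F} => (h : {poly F})) m0 m_min).
    by move=> h h' _ _; apply: val_inj.
  by move=> h; rewrite inE.
apply: leq_trans (leq_mul LL (leqnn _)).
rewrite -(size_image (fun h : {poly_(N - n).+1 F} => (h : {poly F})) L).
apply: (leq_card_fibers (phi := phi)) => x /setIdP[Dx phix].
  have szx : (size (phi x) <= (N - n).+1)%N.
    by have := sphi x Dx; rewrite /lnorm geq_max => /andP[+ _]; clear; size_lia.
  apply/imageP; exists (npolyp _ (phi x)); last by rewrite npolypK.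
  by rewrite inE npolypK // sphi.
have szx : ((size (phi x)).-1 <= N - n)%N.
  by have := sphi x Dx; rewrite /lnorm geq_max => /andP[].
have [s ss sP] := poly_divisors phix.
have -> : (#|F| * 2 ^ (N - n) = #|F| * 2 ^ (N - n) * 1)%N by rewrite muln1.
apply: leq_trans (leq_mul (leq_trans ss _) (leqnn 1)); last first.
  by rewrite leq_mul2l leq_exp2l // szx orbT.
apply: (leq_card_fibers (phi := fun y : {poly_n.+1 F} * {poly_c F} =>
    (y.1 : {poly F}))) => y /setIdP[_ /eqP Ey].
  by apply: sP; rewrite -Ey dvdp_mulr.
apply: leq_trans (subset_leq_card (B := [set y]) _) _; last by rewrite cards1.
apply/subsetP=> z /setIdP[/setIdP[_ /eqP Ez] /eqP zy]; rewrite inE.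
have d0 : (y.1 : {poly F}) != 0.
  by apply: contraNneq phix => d0; rewrite -Ey /phi d0 mul0r.
have Ez2 : (z.2 : {poly F}) = y.2.
  by apply: (mulfI d0); rewrite -/(phi y) Ey -{1}zy -/(phi z) Ez.
by rewrite [z]surjective_pairing [y]surjective_pairing (val_inj zy) (val_inj Ez2).
Qed.

(** With [u = x.1 - x.2] and [v = x.1 + x.2] the difference of squares is [u * v]. For each [u],
    [card_size_mod] applied to [u * Y] replaces the [n.+1] coefficients of [v] by [c] coefficients,
    which leads to [card_small_products]. *)
Lemma card_equal_squares :
  (#|F| ^ c * #|[set x : {poly_n.+1 F} * {poly_n.+1 F} |
      (size (lrem (sq x.1 - sq x.2)%R) <= 2 * n)%N]|
   <= #|F| ^ n.+1 * (#|F| ^ n.+1 + #|F| ^ c + #|F| ^ (N - 2 * n) * (#|F| * 2 ^ (N - n))))%N.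
Proof.
set P := [set x | _].
apply: (@leq_trans (#|F| ^ c * #|[set x : {poly_n.+1 F} * {poly_n.+1 F} |
      (size (lrem ((x.1 : {poly F}) * x.2)) <= 2 * n)%N]|)).
  rewrite leq_mul2l; apply/orP; right.
  have inj : injective (fun x : {poly_n.+1 F} * {poly_n.+1 F} =>
      ((x.1 - x.2 : {poly_n.+1 F}), (x.1 + x.2 : {poly_n.+1 F}))).
    move=> [a b] [a' b'] /= [E1 E2].
    have E1' : (a : {poly F}) - b = (a' : {poly F}) - b' by exact: E1.
    have E2' : (a : {poly F}) + b = (a' : {poly F}) + b' by exact: E2.
    have Ea : (a : {poly F}) = a'.
      apply: (eq_double two_unit).
      have -> : (a : {poly F}) + a = ((a : {poly F}) - b) + ((a : {poly F}) + b) by ring.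
      by rewrite E1' E2'; ring.
    have Eb : (b : {poly F}) = b' by move: E2'; rewrite Ea => /addrI.
    by rewrite (val_inj Ea) (val_inj Eb).
  rewrite -(card_imset _ inj); apply: subset_leq_card; apply/subsetP=> y.
  by case/imsetP=> -[a b]; rewrite !inE /= => Pab -> /=; rewrite -subr_sqr.
have prodE d k : #|[set x : {poly_n.+1 F} * {poly_d F} |
      (size (lrem ((x.1 : {poly F}) * x.2)) <= k)%N]|
    = (\sum_(u : {poly_n.+1 F}) #|[set v : {poly_d F} |
      (size (((v : {poly F}) * ((u : {poly F}) * Y)) %% 'X^(N.+1))%R <= k)%N]|)%N.
  rewrite -sum1_card (eq_bigl (fun x : {poly_n.+1 F} * {poly_d F} =>
    true && (size (lrem ((x.1 : {poly F}) * x.2)) <= k)%N)); last first.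
    by move=> x; rewrite inE.
  rewrite -(pair_big_dep predT (fun (u : {poly_n.+1 F}) (v : {poly_d F}) =>
    (size (lrem ((u : {poly F}) * v)) <= k)%N) (fun _ _ => 1%N)) /=.
  apply: eq_bigr => u _; rewrite sum1_card; apply: eq_card => v; rewrite !inE.
  by rewrite unfold_in /lrem mulrCA mulrA.
apply: leq_trans (leq_mul (leqnn _) card_small_products).
rewrite !prodE !big_distrr /=; apply: leq_sum => u _.
have /= := @card_size_mod F N ((u : {poly F}) * Y) n.+1 c.
have -> : (N.+1 - c = 2 * n)%N by lia.
by rewrite subSS => -> //; move: nN; clear; lia.
Qed.

(** [M] is the size of the fibre over [0] of the map to the top [c] coefficients of [lrem (sq f)].
    The leading term of [card_equal_squares] cancels exactly against the one subtracted in
    [second_moment]. *)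
Lemma card_near_squares_large (R : realFieldType) :
  exists2 M : nat, (#|near_squares| <= M)%N &
    (M%:R - (#|F| ^ n.+1)%:R / (#|F| ^ c)%:R) ^+ 2 <=
    (#|F| ^ n.+1)%:R * (1 + 2 ^+ (N - n)) :> R.
Proof.
pose top (f : {poly_n.+1 F}) : {poly_c F} := npolyp c (lrem (sq f) %/ 'X^(2 * n)).
have X0 : 'X^(2 * n) != 0 :> {poly F} by rewrite -size_poly_gt0 size_polyXn.
have topE f : (top f : {poly F}) = lrem (sq f) %/ 'X^(2 * n).
  rewrite npolypK // size_divp // size_polyXn /=; apply: leq_sub2r.
  exact: size_lrem.
have topP (f g : {poly_n.+1 F}) : top f = top g ->
    (size (lrem (sq f - sq g)%R) <= 2 * n)%N.
  move=> /(congr1 val)/=; rewrite !topE => E; rewrite lremB.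
  rewrite (divp_eq (lrem (sq f)) 'X^(2 * n)) (divp_eq (lrem (sq g)) 'X^(2 * n)) E.
  rewrite opprD addrACA subrr add0r (leq_trans (leq_size_sub _ _)) // geq_max.
  have lt (h : {poly F}) : (size (h %% 'X^(2 * n))%R <= 2 * n)%N.
    by have := ltn_modp h 'X^(2 * n); rewrite X0 size_polyXn ltnS.
  by rewrite !lt.
exists #|[set f | top f == 0]|.
  apply: subset_leq_card; apply/subsetP=> f; rewrite !inE => /and3P[_ _ sr].
  by apply/eqP/val_inj; rewrite /= topE divp_small // size_polyXn ltnS.
have := second_moment R top 0; rewrite !card_npoly => /le_trans; apply.
have q0 : 0 < (#|F| ^ c)%:R :> R.
  by rewrite ltr0n expn_gt0; apply/orP; left; apply/card_gt0P; exists 0.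
rewrite lerBlDr -(ler_pM2l q0) mulrDr -natrM.
apply: le_trans (_ : (#|F| ^ c * #|[set x : {poly_n.+1 F} * {poly_n.+1 F} |
      (size (lrem (sq x.1 - sq x.2)%R) <= 2 * n)%N]|)%:R <= _).
  rewrite ler_nat leq_mul2l; apply/orP; right; apply: subset_leq_card.
  by apply/subsetP=> -[a b]; rewrite !inE /= => /eqP; apply: topP.
apply: le_trans (_ : _ <= (_ : nat)%:R) _; first by rewrite ler_nat; apply: card_equal_squares.
have -> : (#|F| ^ (N - 2 * n) * (#|F| * 2 ^ (N - n)) = #|F| ^ c * 2 ^ (N - n))%N.
  by rewrite mulnA -expnSr subSn.
rewrite !(natrM, natrD) natrX le_eqVlt; apply/orP; left; apply/eqP.
by rewrite (natrX _ 2); field; rewrite gt_eqF.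
Qed.

End Variance.

(** * The two bounds on the number of near squares *)

Section Bounds.
(* [s] is the square root of [q], so that all exponents are integers. *)
Variables (F : finFieldType) (N Q n : nat) (Y : {poly F}) (R : realType) (s : R).
Hypotheses (two_unit : (2 : F) != 0) (nQ : (n <= Q)%N) (QN : (2 * Q <= N <= 4 * Q)%N).
Hypotheses (s1 : 1 <= s) (s2 : s ^+ 2 = #|F|%:R).
Local Notation near_squares := (near_squares N Y n).
Local Notation sq f := ((f : {poly F}) ^+ 2).
Local Notation lnorm := (lnorm N Y).
Local Notation ldet := (ldet N Y).

Let s0 : 0 < s. Proof. exact: lt_le_trans s1. Qed.
Let spos k : 0 < s ^+ k. Proof. exact: exprn_gt0. Qed.
Let sexp k l : (k <= l)%N -> s ^+ k <= s ^+ l. Proof. exact: ler_weXn2l. Qed.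
Let two_exp k l : (k <= l)%N -> (2 : R) ^+ k <= 2 ^+ l.
Proof. by apply: ler_weXn2l; rewrite ler1n. Qed.
Let cardE k : (#|F| ^ k)%:R = s ^+ (2 * k) :> R.
Proof. by rewrite natrX -s2 -exprM. Qed.

Lemma ler_sqr_quadratic (x b : R) : 1 <= b -> x ^+ 2 <= b ^+ 2 + 2 * x -> x <= 3 * b.
Proof. by move=> b1 xb; rewrite leNgt; apply/negP=> lt; nra. Qed.

(** If [2n + lnorm m <= N + 1], all determinants vanish and at most [2q] elements remain. Otherwise
    the exponent in [card_pairs_near_squares] is [4n - N], and the quadratic inequality is solved
    for the count. *)
Lemma near_squares_bound_sqrtN :
  #|near_squares|%:R * s ^+ (2 * N) <= 4 * s ^+ 2 * 2 ^+ N * s ^+ (4 * Q + N).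
Proof.
have [/andP[QN1 QN2]] := QN.
have [m m0 m_min] := lattice_min N Y.
have two1 : 1 <= (2 : R) ^+ N by rewrite exprn_ege1 // ler1n.
have [det0|det0] := leqP (2 * n + lnorm m) N.+1.
  have all0 : near_squares = [set f in near_squares | ldet m (sq f) == 0%R].
    apply/setP=> f; rewrite [RHS]in_set; case: (boolP (f \in _)) => //= Sf.
    symmetry; rewrite -size_poly_leq0 (leq_trans (size_ldet m (lnorm_square Sf))) //.
    by rewrite leqn0 subn_eq0.
  have : #|near_squares|%:R <= 2 * s ^+ 2.
    rewrite s2 -natrM ler_nat mulnC all0; exact: (card_det0_near_squares n m0 m_min).
  have : s ^+ (2 * N) <= s ^+ (4 * Q + N) by apply: sexp; lia.
  move: (spos (2 * N)) (spos 2) (spos (4 * Q + N)) two1.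
  move: (s ^+ (2 * N)) (s ^+ 2) (s ^+ (4 * Q + N)) (2 ^+ N) => A B C D A0 B0 C0 D1 AC K.
  apply: le_trans (_ : 2 * B * C <= _); last first.
    have -> : 4 * B * D * C = 2 * B * C * (2 * D) by ring.
    by rewrite ler_peMr ?mulr_ge0 ?ltW //; lra.
  by apply: ler_pM => //; apply: ltW.
have [->|[f Sf]] := set_0Vmem near_squares.
  by rewrite cards0 mul0r !mulr_ge0 ?exprn_ge0 // ltW.
(* This makes the truncated subtractions below exact. *)
have mn : (lnorm m <= 2 * n)%N.
  apply: leq_trans (lnorm_square Sf); apply: m_min; rewrite sqrf_eq0 -size_poly_gt0.
  by move: Sf; rewrite inE => /and3P[/eqP-> _ _].
have := card_pairs_near_squares n two_unit m0 m_min.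
have -> : (2 * n + lnorm m - N.+1 + ((2 * n).+1 - lnorm m) = 4 * n - N)%N by lia.
rewrite -(ler_nat R) natrD !natrM !natrX => H.
have : #|near_squares|%:R <= 3 * (s ^+ (4 * n - N) * s * 2 ^+ n).
  apply: ler_sqr_quadratic.
    by apply: mulr_ege1; [apply: mulr_ege1|]; rewrite ?exprn_ege1 ?ler1n.
  apply: le_trans H _; rewrite lerD2r -!s2 !exprMn -!exprM.
  by rewrite -expr2 -exprM mulrA [(n * 2)%N]mulnC.
move=> K; apply: le_trans (_ : 3 * (s ^+ (4 * n - N) * s * 2 ^+ n) * s ^+ (2 * N) <= _).
  by rewrite ler_pM2r.
have -> : 3 * (s ^+ (4 * n - N) * s * 2 ^+ n) * s ^+ (2 * N) =
    3 * s * 2 ^+ n * s ^+ (4 * n + N).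
  have -> : (4 * n + N = (4 * n - N) + 2 * N)%N by lia.
  by rewrite exprD; ring.
have ss : s <= s ^+ 2 by rewrite -{1}[s]expr1 sexp.
apply: ler_pM; rewrite ?mulr_ge0 ?exprn_ge0 ?(ltW s0) ?ler0n //; last by apply: sexp; lia.
apply: ler_pM; rewrite ?mulr_ge0 ?exprn_ge0 ?(ltW s0) ?ler0n //; last by apply: two_exp; lia.
by move: ss s0; nra.
Qed.

(** The cases are [lnorm m <= n] and [lnorm m > n]. Multiplied by [q^N], the expected count
    [q^(3n - N)] becomes at most [q^(3Q)]; the parallel squares and the standard deviation go into
    [q^(Q/2 + N)]. *)
Lemma near_squares_bound_sqrtQ :
  #|near_squares|%:R * s ^+ (2 * N) <=
    4 * s ^+ 2 * 2 ^+ N * (s ^+ (6 * Q) + s ^+ (Q + 2 * N)).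
Proof.
have [/andP[QN1 QN2]] := QN.
have [m m0 m_min] := lattice_min N Y.
have sN : s ^+ (2 * N) <= s ^+ (Q + 2 * N) by apply: sexp; lia.
have sQ : s ^+ (6 * n) <= s ^+ (6 * Q) by apply: sexp; lia.
have two1 : 1 <= (2 : R) ^+ N by rewrite exprn_ege1 // ler1n.
have two2 : (2 : R) ^+ n <= 2 ^+ N by apply: two_exp; lia.
have [mn|mn] := leqP (lnorm m) n.
  have := card_near_squares_small two_unit m0 m_min mn.
  rewrite -(ler_nat R) natrD !natrM cardE natrX -s2 => K.
  apply: le_trans (ler_wpM2r (ltW (spos _)) K) _.
  have : s ^+ (2 * (3 * n - N)) * s ^+ (2 * N) <= s ^+ (6 * Q) + s ^+ (Q + 2 * N).
    (* For [3n < N] the truncated exponent is 0 and only [q^N] is left. *)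
    rewrite -exprD; case: (leqP N (3 * n)) => nN.
      by apply: le_trans (_ : s ^+ (6 * Q) <= _); [apply: sexp; lia | rewrite lerDl ltW].
    by apply: le_trans (_ : s ^+ (Q + 2 * N) <= _); [apply: sexp; lia | rewrite lerDr ltW].
  have := spos (2 * N); have := spos (6 * Q); have := spos 2.
  have : 0 < (2 : R) ^+ n by rewrite exprn_gt0.
  move: sN two1 two2; rewrite mulrDl.
  move: (s ^+ (2 * (3 * n - N))) (s ^+ (2 * N)) (s ^+ (6 * Q)) (s ^+ (Q + 2 * N)) => A B C D.
  move: (s ^+ 2) (2 ^+ n) (2 ^+ N) => E G H BD H1 GH G0 E0 C0 B0 AB.
  have AB0 : 0 <= C + D by lra.
  have -> : 4 * E * H * (C + D) = 2 * E * (H * (C + D)) + 2 * E * (H * (C + D)) by ring.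
  have e0 : 0 <= 2 * E by lra.
  apply: lerD.
    by apply: ler_wpM2l => //; apply: le_trans (_ : C + D <= _); [lra | rewrite ler_peMl].
  have -> : 2 * E * G * A * B = 2 * E * (G * (A * B)) by ring.
  apply: ler_wpM2l => //; apply: le_trans (_ : G * (C + D) <= _).
    by rewrite ler_pM2l.
  by rewrite ler_wpM2r.
have nN : (2 * n <= N)%N by lia.
have [M KM] := @card_near_squares_large F N Y n two_unit nN m m0 m_min mn R.
rewrite !cardE => HM.
(* Square root of the variance bound, with [1 + 2 ^+ (N - n)] crudely replaced by the square of
   [2 * 2 ^+ N]. *)
have {}HM : M%:R - s ^+ (2 * n.+1) / s ^+ (2 * (N.+1 - 2 * n)) <= s ^+ n.+1 * (2 * 2 ^+ N).
  have pos : 0 <= s ^+ n.+1 * (2 * 2 ^+ N) by rewrite !mulr_ge0 ?exprn_ge0 // ltW.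
  rewrite real_leNgt ?num_real //; apply/negP=> lt.
  have : (s ^+ n.+1 * (2 * 2 ^+ N)) ^+ 2 <
      (M%:R - s ^+ (2 * n.+1) / s ^+ (2 * (N.+1 - 2 * n))) ^+ 2.
    by rewrite ltrXn2r.
  apply/negP; rewrite -leNgt; apply: le_trans HM _.
  rewrite exprMn -exprM [(n.+1 * 2)%N]mulnC ler_pM2l //.
  have : (2 : R) ^+ (N - n) <= 2 ^+ N by apply: two_exp; lia.
  by move: two1; nra.
apply: le_trans (_ : M%:R * s ^+ (2 * N) <= _); first by rewrite ler_pM2r ?ler_nat.
apply: le_trans (_ : (s ^+ (2 * n.+1) / s ^+ (2 * (N.+1 - 2 * n)) + s ^+ n.+1 * (2 * 2 ^+ N))
   * s ^+ (2 * N) <= _).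
  by rewrite ler_pM2r // -lerBlDl.
rewrite mulrDl.
have -> : s ^+ (2 * n.+1) / s ^+ (2 * (N.+1 - 2 * n)) * s ^+ (2 * N) = s ^+ (6 * n).
  apply: (mulIf (lt0r_neq0 (spos (2 * (N.+1 - 2 * n))))).
  rewrite mulrAC divfK ?lt0r_neq0 // -!exprD; congr (_ ^+ _); lia.
have -> : s ^+ n.+1 * (2 * 2 ^+ N) * s ^+ (2 * N) = 2 * s * 2 ^+ N * s ^+ (n + 2 * N).
  by rewrite exprD exprS; ring.
have sn : s ^+ (n + 2 * N) <= s ^+ (Q + 2 * N) by apply: sexp; lia.
rewrite mulrDr; apply: lerD.
  apply: le_trans sQ _; apply: ler_peMl; first exact: ltW.
  by apply: mulr_ege1 => //; apply: mulr_ege1; rewrite ?exprn_ege1 ?ler1n.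
apply: ler_pM; rewrite ?mulr_ge0 ?exprn_ge0 ?(ltW s0) ?ler0n //.
have ss : s <= s ^+ 2 by rewrite -{1}[s]expr1 sexp.
apply: ler_pM; rewrite ?mulr_ge0 ?exprn_ge0 ?(ltW s0) ?ler0n //.
by move: ss s0; nra.
Qed.

End Bounds.

(** * Additive characters *)

(** Independence of automorphisms: an identically zero trace would be a nontrivial linear relation
    among them. *)
Lemma galTrace_neq0 (K : fieldType) (L : splittingFieldType K) :
  exists a : L, galTrace 1 {:L} a != 0.
Proof.
have [||a _ tr0] := @gal_independent_contra _ L {:L}%AS [in 'Gal({:L} / 1)%g]
  (fun _ => 1) 1%g; [exact: group1 | exact: oner_neq0 | exists a].
apply: contraNneq tr0 => E; rewrite -[X in _ == X]E.
by apply/eqP; apply: eq_bigr => y _; rewrite mul1r.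
Qed.

Section Character.
Local Open Scope complex_scope.
Variables (F : finFieldType) (R : realType).

Local Notation L := (pPrimeCharType (pcharF_pchar F)).

Lemma TrD (x y : F) : Tr (x + y) = Tr x + Tr y.
Proof.
apply: (fmorph_inj (in_alg L)); rewrite rmorphD /= !TrE.
exact: (raddfD (galTrace 1 {:L}) (x : L) (y : L)).
Qed.

Lemma Tr_neq0 : exists x : F, Tr x != 0.
Proof.
have [a tr0] := galTrace_neq0 L; exists a.
by apply: contraNneq tr0 => Tr0; rewrite -TrE Tr0 scale0r.
Qed.

Definition root_of_unity (p n : nat) : R[i] :=
  let theta : R := 2 * pi * n%:R / p%:R in cos theta +i* sin theta.

Lemma root_of_unityD p m n :
  root_of_unity p (m + n) = root_of_unity p m * root_of_unity p n.
Proof.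
rewrite /root_of_unity natrD mulrDr mulrDl cosD sinD.
by simpc; rewrite [X in _ +i* X]addrC [X in _ +i* (X + _)]mulrC.
Qed.

Lemma root_of_unity_modn p n : (0 < p)%N -> root_of_unity p (n %% p) = root_of_unity p n.
Proof.
move=> p0; rewrite [in RHS](divn_eq n p) root_of_unityD.
suff -> : root_of_unity p (n %/ p * p) = 1 by rewrite mul1r.
elim: (n %/ p)%N => [|k IHk].
  by rewrite /root_of_unity mulr0 mul0r cos0 sin0.
rewrite mulSn root_of_unityD IHk mulr1 /root_of_unity mulfK ?pnatr_eq0 ?gtn_eqF //.
by rewrite mulr_natl cos2pi sin2pi.
Qed.

Lemma root_of_unity_neq1 p n : (0 < n < p)%N -> root_of_unity p n != 1.
Proof.
move=> /andP[n0 np]; apply/negP=> /eqP[E _].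
have p0 : 0 < p%:R :> R by rewrite ltr0n (leq_trans _ np).
(* At half the angle, [0 < t < pi] gives [sin t > 0], whereas [cos (2t) = 1] forces [sin t = 0]. *)
pose t : R := pi * n%:R / p%:R.
have : 0 < sin t.
  apply: sin_gt0_pi; rewrite /t -mulrA; apply/andP; split.
    by rewrite mulr_gt0 ?pi_gt0 // divr_gt0 // ltr0n.
  by rewrite gtr_pMr ?pi_gt0 // ltr_pdivrMr // mul1r ltr_nat.
have E2 : 2 * pi * n%:R / p%:R = t *+ 2 by rewrite /t; ring.
move: E; rewrite E2 cos_mulr2n => E; have := cos2Dsin2 t.
move=> cs st; have : sin t ^+ 2 = 0 by move: E cs; rewrite mulr2n; lra.
by move/eqP; rewrite sqrf_eq0 gt_eqF.
Qed.

Definition addchar (x : F) : R[i] := root_of_unity (pcharF F) (Tr x).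

Lemma addcharD x y : addchar (x + y) = addchar x * addchar y.
Proof.
rewrite /addchar TrD -root_of_unityD.
rewrite -[RHS]root_of_unity_modn ?prime_gt0 ?pcharF_prime //.
by congr (root_of_unity _ (_ %% _)); apply: Fp_cast; apply: pcharF_prime.
Qed.

Lemma addchar0 : addchar 0 = 1.
Proof.
have n0 : addchar 0 != 0.
  have := cos2Dsin2 (2 * pi * (Tr (0 : F))%:R / (pcharF F)%:R : R) => cs.
  apply/negP => /eqP[c s]; move: cs.
  by rewrite c s !expr0n addr0 => /eqP; rewrite eq_sym oner_eq0.
by apply: (mulfI n0); rewrite mulr1 -addcharD addr0.
Qed.

Lemma addchar_conj x : (addchar x)^* = addchar (- x).
Proof.
have x0 : addchar x != 0.
  apply/negP=> /eqP E; have := addcharD x (- x); rewrite E mul0r subrr addchar0.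
  by move/eqP; rewrite oner_eq0.
apply: (mulfI x0); rewrite -addcharD subrr addchar0 /addchar /root_of_unity.
set t := _ / _; apply/eqP; rewrite eq_complex /= -(cos2Dsin2 t).
by apply/andP; split; apply/eqP; ring.
Qed.

Lemma addchar_nontrivial : exists x, addchar x != 1.
Proof.
have [x Tr0] := Tr_neq0; exists x; apply: root_of_unity_neq1; apply/andP; split.
  by rewrite lt0n; apply: contraNneq Tr0 => E; apply/eqP/val_inj.
by rewrite -{2}[pcharF F](Fp_cast (pcharF_prime F)) ltn_ord.
Qed.

Lemma sqr_normc_conj (z : R[i]) : (normc z ^+ 2)%:C = z * z^*.
Proof.
case: z => a b; rewrite /normc sqr_sqrtr ?addr_ge0 ?sqr_ge0 //.
by simpc; rewrite -!expr2 [b * a]mulrC addNr.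
Qed.

(** For [h != 0], some monomial [Z] makes the coefficient of t^N in [h * Z] equal to a [c] with
    [addchar c != 1]. Translating [Y] by [Z] multiplies the sum by [addchar c], so it vanishes. *)
Lemma sum_addchar N (h : {poly F}) : (size h <= N.+1)%N ->
  \sum_(Y : {poly_N.+1 F}) addchar (h * Y)`_N = (h == 0)%:R * (#|F| ^ N.+1)%:R.
Proof.
move=> sh; have [->|h0] := eqVneq h 0.
  under eq_bigr do rewrite mul0r coef0 addchar0.
  by rewrite sumr_const card_npoly mul1r.
rewrite mul0r; have [c c1] := addchar_nontrivial.
have sh0 : (0 < size h)%N by rewrite size_poly_gt0.
pose Z : {poly F} := (c / lead_coef h) *: 'X^(N - (size h).-1).
have sZ : (size Z <= N.+1)%N.
  by rewrite (leq_trans (size_scale_leq _ _)) // size_polyXn ltnS leq_subr.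
have hZ : (h * Z)`_N = c.
  rewrite -scalerAr coefZ coefMXn ltnNge leq_subr /= subKn; last by rewrite -ltnS prednK.
  by rewrite -lead_coefE divfK // lead_coef_eq0.
set S := \sum_Y _.
have : addchar c * S = S.
  rewrite mulr_sumr [RHS](reindex_inj (addrI (npolyp N.+1 Z))) /=.
  apply: eq_bigr => Y _; rewrite -addcharD -hZ -coefD -mulrDr.
  by rewrite /= npolypK.
move/eqP; rewrite -{2}[S]mul1r -subr_eq0 -mulrBl mulf_eq0 subr_eq0 (negPf c1).
by move/eqP.
Qed.

Lemma parseval N (a : {poly F} -> R[i]) :
  \sum_(Y : {poly_N.+1 F}) normc (\sum_(g : {poly_N.+1 F})
      a g * addchar ((g : {poly F}) * (Y : {poly F}))`_N) ^+ 2
  = (#|F| ^ N.+1)%:R * \sum_(g : {poly_N.+1 F}) normc (a g) ^+ 2.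
Proof.
apply: (@complexI R); rewrite rmorphM !rmorph_sum /= rmorph_nat mulr_sumr.
transitivity (\sum_(g : {poly_N.+1 F}) \sum_(g' : {poly_N.+1 F})
   a g * (a g')^* * \sum_(Y : {poly_N.+1 F}) addchar (((g : {poly F}) - g') * Y)`_N).
  rewrite (eq_bigr (fun Y : {poly_N.+1 F} => \sum_(g : {poly_N.+1 F}) \sum_(g' : {poly_N.+1 F})
    a g * (a g')^* * addchar (((g : {poly F}) - g') * Y)`_N)); last first.
    move=> Y _; rewrite sqr_normc_conj rmorph_sum /= mulr_suml.
    apply: eq_bigr => g _; rewrite mulr_sumr; apply: eq_bigr => g' _.
    rewrite rmorphM -[X in _ * (X * _)]/((a g')^*).
    rewrite -[X in _ * (_ * X)]/((addchar ((g' : {poly F}) * Y)`_N)^*).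
    by rewrite addchar_conj mulrACA -addcharD mulrBl coefB.
  rewrite exchange_big; apply: eq_bigr => g _.
  by rewrite exchange_big; apply: eq_bigr => g' _; rewrite mulr_sumr.
apply: eq_bigr => g _; rewrite (bigD1 g) //= subrr sum_addchar ?size_poly0 //.
rewrite eqxx mul1r big1 ?addr0 => [|g' g'g].
  by rewrite sqr_normc_conj mulrC.
rewrite sum_addchar; last first.
  by rewrite (leq_trans (size_polyD _ _)) // size_polyN geq_max !size_npoly.
rewrite subr_eq0; case: eqP => [E|_]; last by rewrite mul0r mulr0.
by case/eqP: g'g; apply/val_inj.
Qed.

End Character.

(** * The large sieve *)

(** Translation by 1 permutes [F], so comparing the sums of all elements gives [#|F| = 0] in [F]; if
    2 were 0, an odd [#|F|] would be 1 there. *)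
Lemma odd_card_two_neq0 (F : finFieldType) : odd #|F| -> (2 : F) != 0.
Proof.
move=> oddF; have F0 : #|F|%:R = 0 :> F.
  have : \sum_(x : F) x = \sum_(x : F) x + #|F|%:R.
    rewrite {1}(reindex_inj (addIr 1)) big_split /=; congr (_ + _).
    by rewrite sumr_const.
  by rewrite -[X in X = _]addr0 => /addrI.
apply/negP=> /eqP two0; move/eqP: F0.
by rewrite -[#|F|]odd_double_half oddF natrD -mul2n natrM two0 mul0r addr0 oner_eq0.
Qed.

Section Points.
Variables (F : finFieldType) (N : nat).

(** For [r] reduced modulo [f ^+ 2], these are the digits of [r / f ^+ 2] from t^(-1) to t^(-N-1),
    shifted up by t^(N+1). *)
Definition point (f r : {poly F}) : {poly_N.+1 F} := npolyp N.+1 ((r * 'X^(N.+1)) %/ f ^+ 2).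

Definition near (f Y : {poly F}) : bool :=
  coprimep (lquo N Y (f ^+ 2)) f && (size (lrem N Y (f ^+ 2)) <= 2 * (size f).-1)%N.

Lemma size_square (f : {poly F}) : f != 0 -> size (f ^+ 2) = (2 * (size f).-1).+1.
Proof.
move=> f0; rewrite expr2 size_mul //; have: (0 < size f)%N by rewrite size_poly_gt0.
by size_lia.
Qed.

Lemma pointE (f r : {poly F}) : f != 0 -> (size r <= (size (f ^+ 2)).-1)%N ->
  point f r = (r * 'X^(N.+1)) %/ f ^+ 2 :> {poly F}.
Proof.
move=> f0 sr; rewrite npolypK // size_divp ?expf_neq0 //.
apply: leq_trans (leq_sub2r _ (leq_size_mul _ _)) _; rewrite size_polyXn.
by move: sr; size_lia.
Qed.

(** [f ^+ 2] times the point is [r] t^(N+1) minus a remainder of degree less than [2 deg f <= N];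
    uniqueness of division by t^(N+1) then gives [r]. *)
Lemma point_lquo_rem (f r : {poly F}) : f != 0 -> (size r <= (size (f ^+ 2)).-1)%N ->
  (2 * (size f).-1 <= N)%N ->
  lquo N (point f r) (f ^+ 2) = r /\
  (size (lrem N (point f r) (f ^+ 2)) <= 2 * (size f).-1)%N.
Proof.
move=> f0 sr fN; have f20 : f ^+ 2 != 0 by rewrite expf_neq0.
have st : (size (- ((r * 'X^(N.+1)) %% f ^+ 2))%R <= 2 * (size f).-1)%N.
  by rewrite size_polyN -ltnS -(size_square f0) ltn_modp.
have [|| -> ->] := @lquo_remE F N (point f r) (f ^+ 2) r (- ((r * 'X^(N.+1)) %% f ^+ 2)) => //.
  by rewrite pointE // {2}(divp_eq (r * 'X^(N.+1)) (f ^+ 2)) addrK mulrC.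
by apply: leq_trans st _; apply: leq_trans fN _.
Qed.

(** The tail discarded in [point], once multiplied by [g], contributes only in degrees below
    [deg g <= N], so the coefficient of t^N is unchanged. *)
Lemma echar_point (R : realType) (g : {poly_N.+1 F}) (f r : {poly F}) : f != 0 ->
  (size r <= (size (f ^+ 2)).-1)%N ->
  echar R (laurent_expand ((g : {poly F})%:F * (r%:F / f%:F ^+ 2)))
  = addchar R ((g : {poly F}) * point f r)`_N.
Proof.
move=> f0 sr; have f20 : f ^+ 2 != 0 by rewrite expf_neq0.
rewrite /echar /addchar /root_of_unity.
have -> : (g : {poly F})%:F * (r%:F / f%:F ^+ 2) = ((g : {poly F}) * r)%:F / (f ^+ 2)%:F.
  by rewrite tofracM tofracXn mulrA.
have -> : (-1 : int) = N%:Z - N.+1%:Z by lia.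
rewrite laurent_expandE //.
suff -> : (((g : {poly F}) * r * 'X^(N.+1)) %/ f ^+ 2)`_N = ((g : {poly F}) * point f r)`_N by [].
rewrite pointE // -mulrA {1}(divp_eq (r * 'X^(N.+1)) (f ^+ 2)) mulrDr mulrA.
rewrite divp_addl_mul // coefD [X in _ + X]nth_default ?addr0 //.
rewrite size_divp //; apply: leq_trans (leq_sub2r _ (leq_size_mul _ _)) _.
have := size_npoly g; have := ltn_modp (r * 'X^(N.+1)) (f ^+ 2); rewrite f20.
move: (size (_ %% _)) (size (f ^+ 2)) (size g); lia.
Qed.

(** For fixed [f], [r] is recovered from its point as [lquo], so distinct residues have distinct
    points. *)
Lemma sum_residues (R : realType) (G : {poly_N.+1 F} -> R) (f : {poly F}) :
  (forall Y, 0 <= G Y) -> f != 0 -> (2 * (size f).-1 <= N)%N ->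
  \sum_(r : residue (f ^+ 2) | coprimep r f) G (point f r) <=
    \sum_(Y : {poly_N.+1 F} | near f Y) G Y.
Proof.
move=> G0 f0 fN.
pose h (r : residue (f ^+ 2)) := point f r.
have inj : {in [pred r : residue (f ^+ 2) | coprimep r f] &, injective h}.
  move=> r r' _ _; rewrite /h => E; apply: val_inj.
  have [e1 _] := @point_lquo_rem f r f0 (size_npoly r) fN.
  have [e2 _] := @point_lquo_rem f r' f0 (size_npoly r') fN.
  have eE := congr1 (fun Y : {poly_N.+1 F} => lquo N Y (f ^+ 2)) E.
  exact: etrans (esym e1) (etrans eE e2).
rewrite -[leLHS](big_imset G inj) /= big_mkcond [leRHS]big_mkcond /=.
apply: ler_sum => Y _; case: imsetP => [[r + ->]|_]; last by case: ifP.
rewrite inE => cop; have [E1 E2] := @point_lquo_rem f r f0 (size_npoly r) fN.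
by rewrite /near E1 cop E2.
Qed.

(** The polynomials are split by degree; the factor [Q.+1] is later absorbed into [2 ^ Q]. *)
Lemma card_near (Q k : nat) (Y : {poly F}) :
  (forall n, (n <= Q)%N -> (#|near_squares N Y n| <= k)%N) ->
  (#|[set f : {poly_Q.+1 F} | ((f : {poly F}) != 0%R) && near f Y]| <= Q.+1 * k)%N.
Proof.
move=> Hk; rewrite -[X in (_ <= X * _)%N](size_iota 1 Q.+1).
apply: (leq_card_fibers (phi := fun f : {poly_Q.+1 F} => size (f : {poly F}))) => f.
  rewrite inE => /andP[f0 _]; rewrite mem_iota size_poly_gt0 f0 add1n ltnS.
  exact: size_npoly.
rewrite inE => /andP[f0 _].
have sf : (0 < size (f : {poly F}))%N by rewrite size_poly_gt0.
have nQ : ((size (f : {poly F})).-1 <= Q)%N by rewrite -ltnS prednK ?size_npoly.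
apply: leq_trans (Hk _ nQ).
set n := (size (f : {poly F})).-1; have sfn : size (f : {poly F}) = n.+1 by rewrite prednK.
pose h (g : {poly_Q.+1 F}) : {poly_n.+1 F} := npolyp n.+1 g.
set A := [set g in _ | _].
have hE g : g \in A -> (h g : {poly F}) = g.
  by case/setIdP=> _ /eqP sg; rewrite npolypK // sg sfn.
rewrite -(card_in_imset (f := h)); last first.
  by move=> g g' Ag Ag' /(congr1 val)/= E; apply: val_inj; rewrite /= -(hE g Ag) -(hE g' Ag') E.
apply: subset_leq_card; apply/subsetP=> _ /imsetP[g Ag ->].
have [/setIdP[_ /andP[cop sr]] /eqP sg] := setIdP Ag.
by rewrite inE (hE g Ag) cop sg sfn eqxx /= -[n]/(n.+1.-1) -sfn -sg.
Qed.

End Points.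

Theorem theorem4p1 (R : realType) (q : nat)
    (q_odd : odd q)
    (q_pp : exists p m : nat, [/\ prime p, (0 < m)%N & q = (p ^ m)%N]) :
  exists C : R,
  forall (F : finFieldType) (N Q : nat) (a : {poly F} -> R[i]),
    #|F| = q -> (2 * Q <= N <= 4 * Q)%N ->
    \sum_(f : {poly_Q.+1 F} | (f : {poly F}) != 0)
      \sum_(r : residue ((f : {poly F}) ^+ 2) | coprimep r f)
        normc (\sum_(g : {poly_N.+1 F})
          a g * echar R (laurent_expand
                  ((g : {poly F})%:F * ((r : {poly F})%:F / (f : {poly F})%:F ^+ 2)))) ^+ 2
    <= C * 2 ^+ (Q + N)
       * (q%:R ^+ (3 * Q)
          + Num.min (q%:R `^ (2 * Q%:R + N%:R / 2)) (q%:R `^ (Q%:R / 2 + N%:R)))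
       * \sum_(g : {poly_N.+1 F}) normc (a g) ^+ 2.
Proof.
(* One factor [q] comes from the bounds on [near_squares], the other from the [q ^ N.+1] of
   [parseval]. *)
exists (4 * q%:R ^+ 2) => F N Q a Fq QN; have [/andP[QN1 QN2]] := QN.
have two0 : (2 : F) != 0 by apply: odd_card_two_neq0; rewrite Fq.
have q1 : 1 <= q%:R :> R by rewrite ler1n -Fq; apply/card_gt0P; exists 0.
have q0 : 0 <= q%:R :> R by apply: le_trans q1.
pose s : R := Num.sqrt q%:R.
have s2 : s ^+ 2 = q%:R by rewrite sqr_sqrtr.
have s1 : 1 <= s by rewrite -sqrtr1 ler_sqrt.
have s0 : 0 < s by apply: lt_le_trans s1.
have qs (x : R) (k : nat) : x *+ 2 = k%:R -> q%:R `^ x = s ^+ k.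
  move=> xk; rewrite -powR_mulrn ?(ltW s0) // -xk -s2 -powR_mulrn ?(ltW s0) //.
  by rewrite -powRrM mulr_natl.
have -> : q%:R `^ (2 * Q%:R + N%:R / 2) = s ^+ (4 * Q + N).
  by apply: qs; rewrite natrD natrM; field.
have -> : q%:R `^ (Q%:R / 2 + N%:R) = s ^+ (Q + 2 * N).
  by apply: qs; rewrite natrD natrM; field.
have -> : q%:R ^+ (3 * Q) = s ^+ (6 * Q) by rewrite -s2 -exprM mulnA.
set B := s ^+ (6 * Q) + _; set A := \sum_(g : {poly_N.+1 F}) _.
pose S (Y : {poly_N.+1 F}) : R := normc (\sum_(g : {poly_N.+1 F})
      a g * addchar R ((g : {poly F}) * (Y : {poly F}))`_N) ^+ 2.
have S0 Y : 0 <= S Y by apply: sqr_ge0.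
have bound (n : nat) (Y : {poly F}) : (n <= Q)%N ->
    #|near_squares N Y n|%:R * s ^+ (2 * N) <= 4 * s ^+ 2 * 2 ^+ N * B.
  move=> nQ; have s2F : s ^+ 2 = #|F|%:R by rewrite Fq.
  have := near_squares_bound_sqrtN Y two0 nQ QN s1 s2F.
  have := near_squares_bound_sqrtQ Y two0 nQ QN s1 s2F.
  move=> HsqrtQ HsqrtN; have c0 : 0 <= 4 * s ^+ 2 * 2 ^+ N by rewrite !mulr_ge0 ?exprn_ge0 ?(ltW s0).
  rewrite /B minEle; case: ifP => // _; apply: le_trans HsqrtN _.
  by apply: ler_wpM2l => //; rewrite lerDr exprn_ge0 ?(ltW s0).
apply: le_trans (_ : \sum_(f : {poly_Q.+1 F} | (f : {poly F}) != 0)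
    \sum_(Y : {poly_N.+1 F} | near N f Y) S Y <= _).
  apply: ler_sum => f f0.
  apply: le_trans (sum_residues S0 f0 _); last first.
    by apply: leq_trans QN1; rewrite leq_mul2l /= -subn1 leq_subLR add1n size_npoly.
  rewrite le_eqVlt; apply/orP; left; apply/eqP; apply: eq_bigr => r _.
  rewrite /S; congr (normc _ ^+ 2); apply: eq_bigr => g _.
  by rewrite echar_point // size_npoly.
(* After the exchange each [S Y] is weighted by the number of [f] near [Y]. *)
rewrite (exchange_big_dep predT) //=.
apply: le_trans (_ : \sum_(Y : {poly_N.+1 F})
    (4 * s ^+ 2 * 2 ^+ (Q + N) * B / s ^+ (2 * N)) * S Y <= _).
  apply: ler_sum => Y _; rewrite sumr_const -[leLHS]mulr_natl; apply: ler_wpM2r => //.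
  pose k := \max_(n < Q.+1) #|near_squares N Y n|.
  have kB : k%:R * s ^+ (2 * N) <= 4 * s ^+ 2 * 2 ^+ N * B.
    have [|n kE] := @bigop.eq_bigmax 'I_Q.+1 (fun n => #|near_squares N Y n|).
      by rewrite card_ord.
    have -> : k = #|near_squares N Y n| by exact: kE.
    by apply: bound; rewrite -ltnS.
  have Hk n : (n <= Q)%N -> (#|near_squares N Y n| <= k)%N.
    move=> nQ; rewrite -ltnS in nQ.
    exact: (@bigop.leq_bigmax _ (fun n : 'I_Q.+1 => #|near_squares N Y n|) (Ordinal nQ)).
  have := card_near Hk; rewrite cardsE => cardk.
  rewrite ler_pdivlMr ?exprn_gt0 //.
  apply: le_trans (_ : (Q.+1 * k)%:R * s ^+ (2 * N) <= _).
    by rewrite ler_pM2r ?exprn_gt0 // ler_nat.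
  rewrite natrM -mulrA; apply: le_trans (_ : 2 ^+ Q * (4 * s ^+ 2 * 2 ^+ N * B) <= _).
    apply: ler_pM => //; first by rewrite mulr_ge0 ?exprn_ge0 ?(ltW s0).
    by rewrite -natrX ler_nat ltn_expl.
  by rewrite exprD le_eqVlt; apply/orP; left; apply/eqP; ring.
rewrite -mulr_sumr parseval Fq natrX -/A le_eqVlt; apply/orP; left; apply/eqP.
have -> : q%:R ^+ N.+1 = s ^+ 2 * s ^+ (2 * N) by rewrite -s2 exprS -exprM.
rewrite -s2; field.
by rewrite expf_neq0 // gt_eqF.
Qed.
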